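(* There is a function $g:\mathbb{N}\times\mathbb{N}\to\mathbb{N}$ such that for all integers $k\ge 0$ and $h\geq 1$, every finite poset $P$ of height $h$ whose cover graph has book thickness at most $k$ satisfies $\dim(P)\leq g(k,h)$.
   Context: The height of a poset is the maximum size of a chain. The cover graph of a poset $P$ is the undirected graph on the points of $P$ whose edges are the pairs $\{x,y\}$ with $x<y$ in $P$ and no $z\in P$ with $x<z<y$ in $P$. The dimension $\dim(P)$ is the least $d$ such that there are $d$ linear extensions of $P$ whose intersection is $P$. A book embedding of a graph is a collection of half-planes (pages) all having the same line as their boundary (the spine) such that all vertices of the graph lie on the line, every edge is contained in one of the half-planes, and edges on the same page do not cross. The book thickness of a graph is the smallest number of pages in a book embedding of it. *)

(* Defs.v *)
From HB Require Import structures.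
From mathcomp Require Import all_boot all_order all_algebra.
From mathcomp Require Import all_classical all_reals all_analysis.
From mathcomp Require Import zify ring lra.
Set Implicit Arguments.
Unset Strict Implicit.
Unset Printing Implicit Defensive.
Import Order.TTheory GRing.Theory Num.Theory.
Import numFieldNormedType.Exports.
Local Open Scope ring_scope.

Section Poset.
Local Open Scope order_scope.
Variables (disp : Order.disp_t) (P : finPOrderType disp).

Definition chain (C : {set P}) : bool :=
  [forall x in C, forall y in C, x >=< y].

Definition poset_height : nat := (\max_(C : {set P} | chain C) #|C|)%N.

Definition linear_extension (L : rel P) : Prop :=
  [/\ reflexive L, antisymmetric L, transitive L, total L &
      forall x y, x <= y -> L x y].

(* For [d = 0] the intersection is the full relation, so that posets with at
   most one point have dimension 0. *)
Definition realizer (d : nat) (L : 'I_d -> rel P) : Prop :=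
  (forall i, linear_extension (L i)) /\
  (forall x y, x <= y <-> forall i, L i x y).

Definition has_realizer (d : nat) : Prop := exists L : 'I_d -> rel P, realizer L.

(* Sorting by membership in the principal up-set of [a], then by the size of
   the principal down-set, then arbitrarily, yields a linear extension that
   puts [b] below [a] unless [a <= b]. *)
Let key (a z : P) : nat :=
  (((a <= z)%O * #|P|.+1 + #|[set w : P | (w <= z)%O]|) * #|P| + enum_rank z)%N.

Let key_lt a z w :
  ((a <= z)%O * #|P|.+1 + #|[set u : P | (u <= z)%O]| <
   (a <= w)%O * #|P|.+1 + #|[set u : P | (u <= w)%O]|)%N -> (key a z < key a w)%N.
Proof.
rewrite /key; set m := (X in (X < _)%N); set n := (X in (_ < X)%N) => mn.
apply: leq_trans (leq_addr _ _); apply: leq_trans (leq_mul mn (leqnn _)).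
by rewrite mulSn addnC ltn_add2r.
Qed.

Let key_inj a : injective (key a).
Proof.
move=> z w kzw; apply: enum_rank_inj; apply: val_inj => /=.
have zN := ltn_ord (enum_rank z).
have wN := ltn_ord (enum_rank w).
by move: kzw => /(congr1 (modn^~ #|P|)); rewrite /key !modnMDl !modn_small.
Qed.

Let key_linear a : linear_extension (fun z w => (key a z <= key a w)%N).
Proof.
split=> [z|z w|z w u|z w|z w zw].
- exact: leqnn.
- by rewrite -eqn_leq => /eqP/key_inj.
- exact: leq_trans.
- exact: leq_total.
- have [->//|nzw] := eqVneq z w.
  apply/ltnW/key_lt.
  have sub : (#|[set u : P | (u <= z)%O]| < #|[set u : P | (u <= w)%O]|)%N.
    apply/proper_card/properP; split.
      by apply/fintype.subsetP => u; rewrite !inE => /le_trans; apply.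
    exists w; rewrite !inE //; apply/negP => wz.
    by move/eqP: nzw; apply; apply/le_anti; rewrite zw wz.
  have : ((a <= z)%O <= (a <= w)%O)%N.
    by case: (boolP (a <= z)) => // az; rewrite (le_trans az zw).
  by move: sub; nia.
Qed.

Let ex_realizer : exists d, `[< has_realizer d >].
Proof.
exists #|{: P}|; apply/asboolP.
exists (fun i z w => (key (enum_val i) z <= key (enum_val i) w)%N); split.
  by move=> i; exact: key_linear.
move=> x y; split=> [xy i|].
  by have [_ _ _ _] := key_linear (enum_val i); apply.
move=> /(_ (enum_rank x)); rewrite enum_rankK; apply: contraTT => nxy.
rewrite -ltnNge; apply: key_lt; rewrite lexx (negbTE nxy).
rewrite mul0n add0n mul1n; apply: leq_trans (leq_addr _ _).
by rewrite ltnS max_card.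
Qed.

Definition poset_dim : nat := ex_minn ex_realizer.

End Poset.

Record sgraph (T : finType) := SGraph {
  adj :> rel T;
  adj_sym : symmetric adj;
  adj_irr : irreflexive adj }.

Section CoverGraph.
Local Open Scope order_scope.
Variables (disp : Order.disp_t) (P : finPOrderType disp).

Definition covered (x y : P) : bool := (x < y) && ~~ [exists z, x < z < y].

Let cov (x y : P) := covered x y || covered y x.

Let cov_sym : symmetric cov.
Proof. by move=> x y; rewrite /cov orbC. Qed.

Let cov_irr : irreflexive cov.
Proof. by move=> x; rewrite /cov /covered ltxx. Qed.

Definition cover_graph : sgraph P := SGraph cov_sym cov_irr.

End CoverGraph.

Section BookThickness.
Local Open Scope classical_set_scope.
Variable R : realType.

Definition simple_arc (p q : R * R) (A : set (R * R)) : Prop :=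
  exists f : R -> R * R,
    [/\ {within `[0, 1], continuous f}, {in `[0, 1] &, injective f},
        f 0 = p, f 1 = q & A = f @` `[0, 1]].

Variables (T : finType) (G : sgraph T).

Definition edge_set : {set {set T}} :=
  [set [set p.1; p.2] | p : T * T & G p.1 p.2]%SET.

(* The book consists of [k] copies of the closed upper half-plane, numbered
   0, ..., k-1 and glued along their common boundary, the x-axis, which is the
   spine. The vertex [v] sits at [(pos v, 0)], and the edge [E] is the arc
   [draw E] in the copy numbered [page E]. The values of [page] and [draw] on
   sets that are not edges are irrelevant. *)
Record is_book_embedding (k : nat) (pos : T -> R) (page : {set T} -> nat)
    (draw : {set T} -> set (R * R)) : Prop := {
  pos_inj : injective pos;
  page_lt : forall E, E \in edge_set -> (page E < k)%N;
  draw_arc : forall x y, G x y ->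
    simple_arc (pos x, 0) (pos y, 0) (draw [set x; y]%SET);
  draw_half_plane : forall E, E \in edge_set ->
    draw E `<=` [set p | 0 <= p.2];
  draw_vertex : forall E v, E \in edge_set -> draw E (pos v, 0) -> v \in E;
  draw_noncrossing : forall E F, E \in edge_set -> F \in edge_set -> E != F ->
    page E = page F ->
    draw E `&` draw F `<=` [set (pos v, 0) | v in [set` E :&: F]] }.

Definition has_book_embedding (k : nat) : Prop :=
  exists pos page draw, @is_book_embedding k pos page draw.

(* Every edge is drawn as a parabola on a page of its own. *)
Let ex_book_embedding : exists k, `[< has_book_embedding k >].
Proof.
exists #|{set T}|; apply/asboolP.
pose pos (v : T) : R := (enum_rank v)%:R.
have posI : injective pos.
  by move=> u v /eqP; rewrite eqr_nat => /eqP/val_inj/enum_rank_inj.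
pose page (E : {set T}) : nat := enum_rank E.
pose draw (E : {set T}) : set (R * R) :=
  [set q | 0 <= q.2 /\ q.2 = - \prod_(v in E) (q.1 - pos v)].
exists pos, page, draw; split=> //.
- by move=> E _; exact: ltn_ord.
- move=> x y Gxy.
  have nxy : x != y by apply/eqP => exy; move: Gxy; rewrite exy adj_irr.
  set a := pos x; set b := pos y.
  have ba0 : b - a != 0 by rewrite subr_eq0 eq_sym (inj_eq posI).
  have sq0 : 0 < (b - a) ^+ 2 by rewrite exprn_even_gt0.
  pose f (t : R) : R * R := (a + t * (b - a), t * (1 - t) * (b - a) ^+ 2).
  have prodE (s : R) :
      \prod_(v in [set x; y]%SET) (s - pos v) = (s - a) * (s - b).
    by rewrite big_setU1 ?inE //= big_set1.
  exists f; split.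
  + have c1 : continuous (fun t : R => a + t * (b - a)).
      move=> t; apply: cvgD; first exact: cvg_cst.
      by apply: cvgM; [exact: cvg_id|exact: cvg_cst].
    have c2 : continuous (fun t : R => t * (1 - t) * (b - a) ^+ 2).
      move=> t; apply: cvgM; last exact: cvg_cst.
      apply: cvgM; first exact: cvg_id.
      by apply: cvgB; [exact: cvg_cst|exact: cvg_id].
    apply: continuous_subspaceT => t.
    exact: (cvg_pair (c1 t) (c2 t)).
  + by move=> s t _ _ [/addrI/(mulIf ba0)].
  + by rewrite /f; congr pair; ring.
  + by rewrite /f; congr pair; ring.
  + apply/seteqP; split=> [[q1 q2] /= [q20]|q /= [t]].
      rewrite prodE /= => q2E; exists ((q1 - a) / (b - a)); last first.
        by rewrite /f q2E; congr pair; field.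
      set t := _ / _.
      have q1E : q1 = a + t * (b - a) by rewrite /t; field.
      have : 0 <= t * (1 - t) * (b - a) ^+ 2.
        by rewrite (_ : _ * _ = q2) // q2E q1E; ring.
      by rewrite pmulr_lge0 // in_itv /= => ?; apply/andP; split; nra.
    rewrite in_itv /= => /andP[t0 t1] <-; rewrite /f /draw /= prodE; split; last by ring.
    by rewrite mulr_ge0 ?(ltW sq0) // mulr_ge0 ?subr_ge0.
- by move=> E _ q [].
- move=> E v _ [_] /= /esym/eqP; rewrite oppr_eq0.
  by move=> /prodf_eq0 [u uE]; rewrite subr_eq0 => /eqP/posI ->.
- by move=> E F _ _ /eqP nEF /val_inj/enum_rank_inj /nEF.
Qed.

Definition book_thickness : nat := ex_minn ex_book_embedding.

End BookThickness.

(* Main.v *)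
Require Import Defs.
From mathcomp Require Import all_boot all_order all_algebra.
From mathcomp Require Import all_classical all_reals all_analysis.
From mathcomp Require Import fintype finset zify lra.

(** Two arcs in the half-plane whose ends interleave on the spine must meet, so
    on each page of a book embedding no two edges interleave. From this
    combinatorial layout one bounds linearly the number of internally disjoint
    paths of bounded length joining distinct pairs of a vertex set, by induction
    on the length: the first inner vertices of the paths fall into few runs of
    vertices with the same start, and contracting each run to a point shortens
    the paths. As in Dvorak's bound on admissibility, it follows that every
    nonempty vertex set [S] has a vertex from which the short walks to the rest
    of [S] are hit by a bounded set. Removing such vertices one after the other
    gives an order [pi] with bounded weak reachability and a bounded colouring
    [phi] that separates weakly reachable vertices. Finally, the pairs [(x, y)]
    with [x] not below [y] are classified as in the proof of Joret, Micek, Ossona de Mendez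
    and Wiechert that the dimension is at most [4 ^ c], [c] the weak colouring
    number: for each colour, record whether [x] climbs to a vertex [u] of that
    colour along a chain with [pi]-minimum [u], whether [y] similarly descends
    to some [v], and whether [pi u < pi v]. On an alternating cycle with constant
    signature, the colour of the [pi]-least vertex of the connecting chains
    would give an infinite [pi]-descent. *)

Set Implicit Arguments.
Unset Strict Implicit.
Unset Printing Implicit Defensive.

(** * Noncrossing edges and path systems *)

(* Averaging over all [c]: each [e] is good for at least a quarter of them. *)
Lemma directed_cut (I V : finType) (D : {set I}) (p q : I -> V) :
  exists c : V -> bool,
    #|D| <= 4 * #|[set e in D | c (p e) && ((q e == p e) || ~~ c (q e))]|.
Proof.
pose good (c : {ffun V -> bool}) e := c (p e) && ((q e == p e) || ~~ c (q e)).
have many e : #|{ffun V -> bool}| <= 4 * #|[set c | good c e]|.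
  (* Recolouring [p e] and [q e] makes [c] good for [e]; the two old values are kept as bits, so at
     most four colourings share a recoloured one. *)
  pose phi (c : {ffun V -> bool}) : {ffun V -> bool} * (bool * bool) :=
    ([ffun v => (v == p e) || (v != q e) && c v], (c (p e), c (q e))).
  have phiI : injective phi.
    move=> c c' [/ffunP E Ep Eq]; apply/ffunP => v.
    have [->//|vp] := eqVneq v (p e); have [->//|vq] := eqVneq v (q e).
    by move: (E v); rewrite !ffunE (negbTE vp) vq.
  have <- : #|setX [set c | good c e] [set: bool * bool]| = 4 * #|[set c | good c e]|.
    by rewrite cardsX cardsT card_prod card_bool mulnC.
  rewrite -(card_imset _ phiI).
  apply/subset_leq_card/subsetP => _ /imsetP[c _ ->].
  by rewrite !inE /good !ffunE !eqxx /= andbT; case: (q e == p e).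
pose cut (c : {ffun V -> bool}) := #|[set e in D | good c e]|.
case: (boolP [exists c, #|D| <= 4 * cut c]) => [/existsP[c cP]|/existsPn none].
  by exists c.
have F0 : 0 < #|{ffun V -> bool}| by apply/card_gt0P; exists [ffun=> false].
have swap : \sum_(c : {ffun V -> bool}) cut c = \sum_(e in D) #|[set c | good c e]|.
  have cutE c : cut c = \sum_(e in D) (good c e : nat).
    rewrite /cut -sum1_card big_mkcond [RHS]big_mkcond; apply: eq_bigr => e _.
    by rewrite inE; case: (e \in D); case: (good c e).
  have goodE e : #|[set c | good c e]| = \sum_(c : {ffun V -> bool}) (good c e : nat).
    rewrite -sum1_card big_mkcond; apply: eq_bigr => c _.
    by rewrite inE; case: (good c e).
  rewrite (eq_bigr _ (fun c _ => cutE c)) exchange_big /=.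
  by apply: eq_bigr => e _; rewrite goodE.
have lo : #|D| * #|{ffun V -> bool}| <= 4 * \sum_(c : {ffun V -> bool}) cut c.
  rewrite swap big_distrr /= -sum_nat_const; exact: leq_sum.
have hi : 4 * (\sum_(c : {ffun V -> bool}) cut c) + #|{ffun V -> bool}|
    <= #|D| * #|{ffun V -> bool}|.
  rewrite big_distrr /= mulnC -sum_nat_const -[X in _ + X]sum1_card -big_split /=.
  by apply: leq_sum => c _; have := none c; lia.
lia.
Qed.

(* Ordered: the leftmost of the four ends belongs to the edge [a b]; the other
   case is [crossing c d a b]. *)
Definition crossing (a b c d : nat) :=
  [&& minn a b < minn c d, minn c d < maxn a b & maxn a b < maxn c d].

Lemma noncrossing_inside p q r s :
  ~~ crossing p q r s -> ~~ crossing r s p q ->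
  r != p -> r != q -> s != p -> s != q ->
  (minn p q < r < maxn p q) = (minn p q < s < maxn p q).
Proof.
rewrite /crossing => + + rp rq sp sq.
case: (ltngtP r s) => [rs|sr|->//]; case: (ltngtP p q) => pq; last 1 first.
all: try by move=> *; apply/idP/idP => /andP[]; lia.
all: case: (ltngtP r p) rp => // rp _; case: (ltngtP r q) rq => // rq _;
  case: (ltngtP s p) sp => // sp _; case: (ltngtP s q) sq => // sq _; rewrite ?andbT ?andbF //=; move=> *; exfalso; lia.
Qed.

(** Since [x2] and [x4] are both joined to [a], no edge at [b] separates them. The edge to [x1] thus
    keeps [b] from lying between [x2] and [x4], and the edge to [x3] makes [b < x2] equivalent to
    [x4 < b], which is absurd. *)
Lemma no_abab a b x1 x2 x3 x4 : a != b ->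
  x1 < x2 -> x2 < x3 -> x3 < x4 ->
  a \notin [:: x1; x2; x3; x4] -> b \notin [:: x1; x2; x3; x4] ->
  ~~ crossing b x1 a x2 -> ~~ crossing a x2 b x1 ->
  ~~ crossing b x1 a x4 -> ~~ crossing a x4 b x1 ->
  ~~ crossing b x3 a x2 -> ~~ crossing a x2 b x3 ->
  ~~ crossing b x3 a x4 -> ~~ crossing a x4 b x3 -> False.
Proof.
move=> ab x12 x23 x34; rewrite !inE !negb_or => /and4P[a1 a2 a3 a4] /and4P[b1 b2 b3 b4].
have [x21 x23' x41 x43] : [/\ x2 != x1, x2 != x3, x4 != x1 & x4 != x3] by split; lia.
have x2b : x2 != b by rewrite eq_sym.
have x4b : x4 != b by rewrite eq_sym.
move=> /noncrossing_inside h1 /h1 /(_ ab a1 x2b x21) {}h1.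
move=> /noncrossing_inside h2 /h2 /(_ ab a1 x4b x41) {}h2.
move=> /noncrossing_inside h3 /h3 /(_ ab a3 x2b x23') {}h3.
move=> /noncrossing_inside h4 /h4 /(_ ab a3 x4b x43) {}h4.
have := etrans (esym h1) h2; have := etrans (esym h3) h4; clear -b1 b2 b3 b4 x12 x23 x34.
by case: (ltngtP b x1) b1 => // b1 _; case: (ltngtP b x3) b3 => // b3 _; lia.
Qed.

(* In the order given by [x], [rep e] is the last edge of the maximal run of
   edges around [e] with the same [u]-end. Every run either is the last one of
   its [u]-end or is followed by the first one of another [u]-end, since a
   pattern b a b a would force a crossing. *)
Lemma run_ends (I V : finType) (D : {set I}) (y : V -> nat) (u : I -> V) (x : I -> nat) :
  injective y -> {in D &, injective x} ->
  {in D &, forall e f, y (u e) != x f} ->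
  {in D &, forall e f, ~~ crossing (y (u e)) (x e) (y (u f)) (x f)} ->
  exists rep : I -> I,
    [/\ {in D, forall e, [/\ rep e \in D, u (rep e) = u e & x e <= x (rep e)]},
        {in D &, forall e f, x e <= x f <= x (rep e) -> rep f = rep e} &
        #|rep @: D| <= 2 * #|u @: D| ].
Proof.
move=> yI xI dis ncr.
pose ext e f := (x e <= x f) &&
  [forall g in D, (x e <= x g <= x f) ==> (u g == u e)].
pose rep e := [arg max_(f > e | (f \in D) && ext e f) x f].
have extP e f : reflect (x e <= x f /\ forall g, g \in D -> x e <= x g <= x f -> u g = u e)
    (ext e f).
  apply: (iffP andP) => -[ef H]; split=> //.
    by move=> g gD gb; apply/eqP; move/forall_inP: H => /(_ g gD) /implyP; apply.
  by apply/forall_inP => g gD; apply/implyP => gb; apply/eqP/H.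
have repP e : e \in D -> [/\ rep e \in D, ext e (rep e) &
    forall f, f \in D -> ext e f -> x f <= x (rep e)].
  move=> eD; rewrite /rep; case: arg_maxnP => [|r /andP[rD er] rmax].
    rewrite eD; apply/extP; split=> // g gD /andP[g1 g2].
    by rewrite (xI e g) //; apply/eqP; rewrite eqn_leq g1.
  by split=> // f fD ef; apply: rmax; rewrite fD.
have rep1 : {in D, forall e, [/\ rep e \in D, u (rep e) = u e & x e <= x (rep e)]}.
  move=> e eD; have [rD /extP[er H] _] := repP e eD.
  by split=> //; apply: H => //; rewrite er leqnn.
have rep2 : {in D &, forall e f, x e <= x f <= x (rep e) -> rep f = rep e}.
  move=> e f eD fD /andP[ef fr].
  have [rD /extP[er eH] emax] := repP e eD; have [sD /extP[fs fH] fmax] := repP f fD.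
  have fe : u f = u e by apply: eH => //; rewrite ef.
  apply: xI => //; apply/eqP; rewrite eqn_leq; apply/andP; split.
    apply: emax => //; apply/extP; split; first by lia.
    move=> g gD gb; case: (leqP (x g) (x (rep e))) => gr; first by apply: eH => //; lia.
    by rewrite -fe; apply: fH => //; lia.
  apply: fmax => //; apply/extP; split=> // g gD gb.
  by rewrite fe; apply: eH => //; lia.
exists rep; split=> //.
have RpD r : r \in rep @: D -> r \in D /\ rep r = r.
  case/imsetP=> e eD ->; have [rD _ er] := rep1 e eD; split=> //.
  by apply: rep2 => //; rewrite er leqnn.
pose L := [set r in rep @: D | [forall g in D, (u g == u r) ==> (x g <= x r)]].
have LL : #|L| <= #|u @: D|.
  rewrite -(@card_in_imset _ _ u (mem L)).
    apply/subset_leq_card/subsetP => _ /imsetP[r + ->]; rewrite inE => /andP[/RpD[rD _] _].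
    exact: imset_f.
  move=> r r'; rewrite !inE => /andP[/RpD[rD _] /forall_inP rl].
  move=> /andP[/RpD[rD' _] /forall_inP rl'] ur; apply: xI => //.
  have := implyP (rl' r rD); have := implyP (rl r' rD'); rewrite ur eqxx.
  by move=> /(_ isT) h1 /(_ isT) h2; apply/eqP; rewrite eqn_leq h1 h2.
(* The inner arg max is only a default value: if [r] is not in [L], some edge lies to the right of
   [r], hence so does the rightmost one. *)
pose nx r := [arg min_(g < [arg max_(f > r in D) x f] | (g \in D) && (x r < x g)) x g].
have nxP r : r \in rep @: D -> r \notin L ->
  [/\ nx r \in D, x r < x (nx r), forall g, g \in D -> x r < x g -> x (nx r) <= x g &
      forall g, g \in D -> u g = u (nx r) -> x (nx r) <= x g].
  move=> rR; have [rD rr] := RpD r rR.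
  rewrite inE rR /= => /forall_inPn [g' g'D]; rewrite negb_imply -ltnNge => /andP[/eqP ug' rg'].
  rewrite /nx; case: arg_minnP => [|n /andP[nD rn] nmin].
    by case: arg_maxnP => // m mD mmax; apply/andP; split=> //; exact: leq_trans rg' (mmax _ g'D).
  have nmin' g : g \in D -> x r < x g -> x n <= x g by move=> *; apply: nmin; apply/andP.
  (* Otherwise [n] would prolong the run that ends at [r]. *)
  have unr : u n <> u r.
    move=> unr; have [_ _ rmax] := repP r rD.
    have : x n <= x (rep r).
      apply: rmax => //; apply/extP; split; first exact: ltnW.
      move=> g gD /andP[rg gn]; have [grE|gr] := eqVneq (x g) (x r).
        by rewrite (xI g r).
      have /(nmin' g gD) ng : x r < x g by lia.
      by rewrite (xI g n) //; lia.
    by rewrite rr; lia.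
  split=> // g gD ug; rewrite leqNgt; apply/negP => gn.
  have gr : x g < x r.
    have [grE|gr] := eqVneq (x g) (x r); first by case: unr; rewrite -ug (xI g r).
    by case: (ltnP (x r) (x g)) => [/(nmin' g gD)|]; lia.
  have ng' : x n < x g'.
    have [grE|gr'] := eqVneq (x g') (x n); first by case: unr; rewrite -ug' (xI g' n).
    by have := nmin' g' g'D rg'; lia.
  have yab : y (u n) != y (u r) by apply/eqP => /yI.
  have nc e f a b : e \in D -> f \in D -> y (u e) = a -> y (u f) = b ->
    ~~ crossing a (x e) b (x f) by move=> eD fD <- <-; exact: ncr.
  have disl e : e \in D -> y (u e) \notin [:: x g; x r; x n; x g'].
    by move=> eD; rewrite !inE !negb_or !dis.
  apply: (no_abab (a := y (u r)) (b := y (u n)) _ gr rn ng'); rewrite ?disl //;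
    first (by apply/eqP => /yI/esym); by apply: nc; rewrite ?ug ?ug'.
have RL : #|rep @: D :\: L| <= #|u @: D|.
  rewrite -(@card_in_imset _ _ (u \o nx) (mem (rep @: D :\: L))).
    apply/subset_leq_card/subsetP => _ /imsetP[r + ->]; rewrite inE => /andP[rL rR].
    by have [nD _ _ _] := nxP r rR rL; exact: imset_f.
  move=> r r' /setDP[rR rL] /setDP[rR' rL'] /= E.
  have [nD rn nmin nfst] := nxP r rR rL; have [nD' rn' nmin' nfst'] := nxP r' rR' rL'.
  have [rD _] := RpD r rR; have [rD' _] := RpD r' rR'.
  have := nfst _ nD' (esym E); have := nfst' _ nD E => h1 h2.
  apply: xI => //; have := nmin r' rD'; have := nmin' r rD; lia.
by have := cardsID L (rep @: D); have := subset_leq_card (subsetIr (rep @: D) L); lia.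
Qed.

Lemma crossingC a b c d : crossing b a d c = crossing a b c d.
Proof. by rewrite /crossing (minnC b) (maxnC b) (minnC d) (maxnC d). Qed.

Lemma crossing_shared a b d : crossing a b a d = false.
Proof.
by rewrite /crossing; case: (ltngtP a b) => ?; case: (ltngtP a d) => ?; lia.
Qed.

Lemma card_le_classes (I : finType) (D : {set I}) (h : I -> nat) k B :
  {in D, forall e, h e < k} -> (forall p, p < k -> #|[set e in D | h e == p]| <= B) ->
  #|D| <= k * B.
Proof.
elim: k D => [|k IH] D hk hB.
  by rewrite leqn0 cards_eq0; apply/eqP/setP => e; rewrite inE; apply/negP => /hk.
have := hB k (ltnSn k); rewrite -(cardsID [set e in D | h e == k] D) => Bk.
have /setIidPr -> : [set e in D | h e == k] \subset D.
  by apply/subsetP => e; rewrite inE => /andP[].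
rewrite mulSn leq_add // IH // => [e|p pk].
  by rewrite !inE => /andP[+ eD]; rewrite eD /=; have := hk e eD; lia.
apply: leq_trans (hB p (ltnW pk)); apply/subset_leq_card/subsetP => e.
by rewrite !inE => /andP[/andP[_ ->] ->].
Qed.

(* Each edge is the longest one at its left end or the longest one at its
   right end. *)
Lemma card_rightward_noncrossing (I V : finType) (y : V -> nat) (u v : I -> V) (D : {set I}) :
  injective y -> {in D, forall e, y (u e) < y (v e)} ->
  {in D &, forall e f, ~~ crossing (y (u e)) (y (v e)) (y (u f)) (y (v f))} ->
  {in D &, forall e f, u e = u f -> v e = v f -> e = f} ->
  #|D| <= #|u @: D| + #|v @: D|.
Proof.
move=> yI lt ncr inj.
pose A := [set e in D | [forall f in D, (u f == u e) ==> (y (v f) <= y (v e))]].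
rewrite -(cardsID A D); apply: leq_add.
  rewrite -(@card_in_imset _ _ u (mem (D :&: A))).
    apply/subset_leq_card/subsetP => _ /imsetP[e /setIP[eD _] ->]; exact: imset_f.
  move=> e f /setIP[eD eA] /setIP[fD fA] uE; apply: inj => //; apply: yI.
  move: eA fA; rewrite !inE eD fD /= => /forall_inP /(_ f fD) eA /forall_inP /(_ e eD).
  by move: eA; rewrite uE eqxx /= => eA fA; apply/eqP; rewrite eqn_leq eA fA.
rewrite -(@card_in_imset _ _ v (mem (D :\: A))).
  apply/subset_leq_card/subsetP => _ /imsetP[e /setDP[eD _] ->]; exact: imset_f.
have longer e : e \in D -> e \notin A ->
    exists f, [/\ f \in D, u f = u e & y (v e) < y (v f)].
  move=> eD; rewrite inE eD /= => /forall_inPn[f fD].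
  by rewrite negb_imply -ltnNge => /andP[/eqP ? ?]; exists f.
(* An edge that is longer than [f] at the left end of [f] would cross [e]. *)
have main e f : e \in D :\: A -> f \in D :\: A -> v e = v f -> y (u e) < y (u f) -> False.
  move=> /setDP[eD eA] /setDP[fD fA] vE uef.
  have [f' [f'D uf' vf']] := longer f fD fA.
  have := ncr e f' eD f'D; have := lt e eD; have := lt f fD; have := lt f' f'D.
  rewrite /crossing uf' vE => l1 l2 l3.
  by rewrite !(minn_idPl (ltnW _)) // !(maxn_idPr (ltnW _)) // -?vE // vE; lia.
move=> e f eDA fDA vE; have [eD _] := setDP eDA; have [fD _] := setDP fDA.
case: (ltngtP (y (u e)) (y (u f))) => uef.
- by case: (main e f eDA fDA vE uef).
- by case: (main f e fDA eDA (esym vE) uef).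
by apply: inj => //; apply: yI.
Qed.

Lemma card_noncrossing (I V : finType) (y : V -> nat) (u v : I -> V) (D : {set I}) :
  injective y -> {in D, forall e, u e != v e} ->
  {in D &, forall e f, ~~ crossing (y (u e)) (y (v e)) (y (u f)) (y (v f))} ->
  {in D &, forall e f, u e = u f -> v e = v f -> e = f} ->
  #|D| <= 2 * (#|u @: D| + #|v @: D|).
Proof.
move=> yI ne ncr inj; pose A := [set e in D | y (u e) < y (v e)].
have AD : A \subset D by apply/subsetP => e; rewrite inE => /andP[].
have BD : D :\: A \subset D by exact: subsetDl.
rewrite -(cardsID A D) (setIidPr AD) mul2n -addnn; apply: leq_add.
  apply: leq_trans (leq_add (subset_leq_card (imsetS u AD)) (subset_leq_card (imsetS v AD))).
  apply: (card_rightward_noncrossing yI).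
  - by move=> e; rewrite inE => /andP[].
  - by move=> e f /(subsetP AD) eD /(subsetP AD) fD; exact: ncr.
  - by move=> e f /(subsetP AD) eD /(subsetP AD) fD; exact: inj.
apply: leq_trans (leq_add (subset_leq_card (imsetS u BD)) (subset_leq_card (imsetS v BD))).
rewrite addnC; apply: (card_rightward_noncrossing yI).
- move=> e /setDP[eD]; rewrite inE eD /= -leqNgt leq_eqVlt => /orP[/eqP/yI E|//].
  by have := ne e eD; rewrite E eqxx.
- by move=> e f /(subsetP BD) eD /(subsetP BD) fD; rewrite crossingC; exact: ncr.
- by move=> e f /(subsetP BD) eD /(subsetP BD) fD vE uE; exact: inj.
Qed.

Lemma crossing_disjoint a b c d : b <= a -> a < d -> d <= c ->
  crossing a b c d = false /\ crossing c d a b = false.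
Proof.
move=> ba ad dc; rewrite /crossing (minn_idPr ba) (maxn_idPl ba) (minn_idPr dc) (maxn_idPl dc).
by split; lia.
Qed.

(** Sliding [a] back to [a'] and [c] back to [c'] passes neither [b] nor [d], and neither sliding
    end passes the other, so all comparisons that define a crossing survive. *)
Lemma crossing_contract a a' b c c' d :
  a' <= a -> c' <= c -> (a < c -> a < c') -> (c < a -> c < a') ->
  ~~ (a' <= b <= a) -> ~~ (a' <= d <= a) -> ~~ (c' <= b <= c) -> ~~ (c' <= d <= c) ->
  crossing a b c d -> crossing a' b c' d.
Proof.
move=> a'a c'c ac ca; rewrite !negb_and -!ltnNge => ab ad cb cd.
have e1 : (a < b) = (a' < b) by lia.
have e2 : (b < a) = (b < a') by lia.
have e3 : (a < d) = (a' < d) by lia.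
have e4 : (d < a) = (d < a') by lia.
have e5 : (c < b) = (c' < b) by lia.
have e6 : (b < c) = (b < c') by lia.
have e7 : (c < d) = (c' < d) by lia.
have e8 : (d < c) = (d < c') by lia.
have f1 : a < c -> a' < c' by lia.
have f2 : c < a -> c' < a' by lia.
clear ab ad cb cd ac ca a'a c'c; rewrite /crossing /minn /maxn e1 e7.
case: (a' < b) e1 => e1; case: (c' < d) e7 => e7; rewrite ?e2 ?e4 ?e3 ?e8 ?e5 ?e6; move=> /and3P[h1 h2 h3].
all: apply/and3P; split; try assumption; try (by apply: f1); try (by apply: f2); by rewrite -?e2 -?e4 -?e3 -?e8 -?e5 -?e6.
Qed.

Section PathSystems.
Variables (I V : finType) (y : V -> nat).
Hypothesis yI : injective y.

(* [x i e] is the [i]-th vertex of the path [e], which has [l.+1] edges. *)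
Record book_paths (k l : nat) (x : nat -> I -> V) (pg : nat -> I -> nat)
    (D : {set I}) : Prop := {
  bp_page : forall i, i <= l -> {in D, forall e, pg i e < k};
  bp_noncrossing : forall i, i <= l -> {in D &, forall e f, pg i e = pg i f ->
    ~~ crossing (y (x i e)) (y (x i.+1 e)) (y (x i f)) (y (x i.+1 f))};
  bp_inner : forall i, 0 < i <= l -> {in D &, injective (x i)};
  bp_disjoint : forall i, i <= l -> {in D &, forall e f, (0 < l) || (e == f) ->
    x i e != x i.+1 f};
  bp_ends : {in D &, forall e f, x 0 e = x 0 f -> x l.+1 e = x l.+1 f -> e = f} }.

Lemma book_paths_sub k l x pg (D D' : {set I}) :
  D' \subset D -> book_paths k l x pg D -> book_paths k l x pg D'.
Proof.
move=> /subsetP sD [h1 h2 h3 h4 h5]; split.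
- by move=> i il e /sD; exact: h1.
- by move=> i il e f /sD eD /sD; exact: h2.
- by move=> i il e f /sD eD /sD; exact: h3.
- by move=> i il e f /sD eD /sD; exact: h4.
- by move=> e f /sD eD /sD; exact: h5.
Qed.

(** The first two vertices of each path are merged into [u e]. Distinct paths keep distinct pairs of
    ends because [u e] determines [x 0 e]. *)
Lemma book_paths_contract k l x pg (D : {set I}) (u : I -> V) :
  book_paths k l.+1 x pg D ->
  {in D &, forall e f, u e != x 2 f} ->
  {in D &, forall e f, pg 1 e = pg 1 f ->
    ~~ crossing (y (u e)) (y (x 2 e)) (y (u f)) (y (x 2 f))} ->
  {in D &, forall e f, u e = u f -> x 0 e = x 0 f} ->
  book_paths k l (fun i => if i is 0 then u else x i.+1) (fun i => pg i.+1) D.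
Proof.
move=> [h1 h2 h3 h4 h5] u2 ncr u0; split.
- by move=> i il e eD; exact: h1.
- by move=> [|i] il e f eD fD pE; [exact: ncr|exact: h2].
- by move=> [|i] // il; exact: h3.
- by move=> [|i] il e f eD fD _; [exact: u2|exact: h4].
- by move=> e f eD fD uE xE; apply: h5 => //; exact: u0.
Qed.

(** Single edges give [2 * k]. Every inner vertex costs a factor [k] for the page of the first edge
    and a factor 10 for the contraction. *)
Definition path_density (k l : nat) : nat := 2 * k * (10 * k) ^ l.

Theorem card_book_paths k l x pg (D : {set I}) :
  book_paths k l x pg D ->
  #|D| <= path_density k l * (#|x 0 @: D| + #|x l.+1 @: D|).
Proof.
elim: l x pg D => [|l IH] x pg D bp.
  rewrite /path_density expn0 muln1 (mulnC 2) -mulnA.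
  apply: (card_le_classes (h := pg 0)) => [|p pk]; first exact: (bp_page bp).
  set Dp := [set e in D | pg 0 e == p].
  have sD : Dp \subset D by apply/subsetP => e; rewrite inE => /andP[].
  have bpp := book_paths_sub sD bp.
  apply: leq_trans (_ : 2 * (#|x 0 @: Dp| + #|x 1 @: Dp|) <= _).
    apply: (card_noncrossing yI).
    - by move=> e eD; apply: (bp_disjoint bpp) => //; rewrite eqxx.
    - move=> e f eD fD; apply: (bp_noncrossing bpp) => //.
      by move: eD fD; rewrite !inE => /andP[_ /eqP->] /andP[_ /eqP->].
    - exact: (bp_ends bpp).
  by rewrite leq_mul2l leq_add ?orbT // subset_leq_card // imsetS.
have -> : path_density k l.+1 = k * (10 * path_density k l).
  by rewrite /path_density expnS; lia.
rewrite -mulnA; apply: (card_le_classes (h := pg 0)) => [|p pk].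
  exact: (bp_page bp).
set Dp := [set e in D | pg 0 e == p].
have sD : Dp \subset D by apply/subsetP => e; rewrite inE => /andP[].
have {}bp := book_paths_sub sD bp.
have xI : {in Dp &, injective (fun e => y (x 1 e))}.
  by move=> e f eD fD /yI; apply: (bp_inner bp).
have [||rep [rep1 rep2 rep3]] := run_ends (D := Dp) (u := x 0) yI xI.
- move=> e f eD fD; apply/eqP => /yI/eqP.
  by apply/negP; apply: (bp_disjoint bp).
- move=> e f eD fD; apply: (bp_noncrossing bp) => //.
  by move: eD fD; rewrite !inE => /andP[_ /eqP->] /andP[_ /eqP->].
(* The runs span disjoint intervals, so a run that ends to the right of [x 1 (rep e)] lies there
   entirely. *)
have rep_mono e f : e \in Dp -> f \in Dp -> y (x 1 (rep e)) < y (x 1 (rep f)) ->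
    y (x 1 (rep e)) < y (x 1 f).
  move=> eD fD lt; rewrite ltnNge; apply/negP => fe.
  have [rD _ er] := rep1 e eD; have [sD' _ fs] := rep1 f fD.
  have E : rep (rep e) = rep f by apply: rep2 => //; rewrite fe ltnW.
  have E' : rep (rep e) = rep e by apply: rep2 => //; rewrite er leqnn.
  by move: lt; rewrite -E E' ltnn.
have repI e f : e \in Dp -> f \in Dp -> x 1 (rep e) = x 1 (rep f) -> rep e = rep f.
  move=> eD fD E; have [rD _ _] := rep1 e eD; have [rD' _ _] := rep1 f fD.
  by apply: xI => //; rewrite E.
pose u e := x 1 (rep e).
have u0 e f : e \in Dp -> f \in Dp -> u e = u f -> x 0 e = x 0 f.
  move=> eD fD /(repI _ _ eD fD) E.
  by have [_ <- _] := rep1 e eD; have [_ <- _] := rep1 f fD; rewrite E.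
have u2 e f : e \in Dp -> f \in Dp -> u e != x 2 f.
  by move=> eD fD; apply: (bp_disjoint bp) => //; have [] := rep1 e eD.
have usize : #|u @: Dp| <= 2 * #|x 0 @: Dp|.
  apply: leq_trans rep3; rewrite /u (imset_comp (x 1) rep); exact: leq_imset_card.
(* [w] lies in the spine interval spanned by the run of [r], which ends at [u r]. *)
pose inrun r w := [exists e in Dp, (rep e == rep r) && (y (x 1 e) <= y w <= y (u r))].
have step (D' : {set I}) : D' \subset Dp ->
    {in D' &, forall e f, pg 1 e = pg 1 f ->
      ~~ crossing (y (u e)) (y (x 2 e)) (y (u f)) (y (x 2 f))} ->
    #|D'| <= path_density k l * (2 * #|x 0 @: D| + #|x l.+2 @: D|).
  move=> sD' ncr; have sD'' := subsetP sD'.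
  have bp' : book_paths k l (fun i => if i is 0 then u else x i.+1) (fun i => pg i.+1) D'.
    apply: book_paths_contract (book_paths_sub sD' bp) _ ncr _.
      by move=> e f /sD'' eD /sD'' fD; exact: u2.
    by move=> e f /sD'' eD /sD'' fD; exact: u0.
  apply: leq_trans (IH _ _ _ bp') _; rewrite leq_mul2l; apply/orP; right.
  apply: leq_add; last by rewrite subset_leq_card // imsetS // (subset_trans sD').
  apply: leq_trans (leq_trans usize _); first by rewrite subset_leq_card // imsetS.
  by rewrite leq_mul2l /= subset_leq_card // imsetS.
(* If [x 2 e] lies within the run of [e], the contracted edges stay inside
   disjoint intervals. *)
pose D1 := [set e in Dp | inrun e (x 2 e)].
have s1 : D1 \subset Dp by apply/subsetP => e; rewrite inE => /andP[].
have c1 : #|D1| <= path_density k l * (2 * #|x 0 @: D| + #|x l.+2 @: D|).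
  apply: step => // e f.
  rewrite !inE => /andP[/andP[eD /eqP ep] /exists_inP[e' e'D /andP[/eqP re' ew]]].
  move=> /andP[/andP[fD /eqP fp] /exists_inP[f' f'D /andP[/eqP rf' fw]]] _.
  have {ep}eDp : e \in Dp by rewrite inE eD ep eqxx.
  have {fp}fDp : f \in Dp by rewrite inE fD fp eqxx.
  have [E|ne] := eqVneq (u e) (u f); first by rewrite E crossing_shared.
  move: ew fw => /andP[e1 e2] /andP[f1 f2].
  case: (ltngtP (y (u e)) (y (u f))) => [lt|lt|/yI E]; last by rewrite E eqxx in ne.
    have := rep_mono e f' eDp f'D; rewrite rf' => /(_ lt) h.
    by rewrite (crossing_disjoint e2 (leq_trans h f1) f2).1.
  have := rep_mono f e' fDp e'D; rewrite re' => /(_ lt) h.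
  by rewrite (crossing_disjoint f2 (leq_trans h e1) e2).2.
have inrun_uniq e f w : e \in Dp -> f \in Dp -> inrun e w -> inrun f w -> u e = u f.
  move=> eD fD /exists_inP[e' e'D /and3P[/eqP re e1 e2]].
  move=> /exists_inP[f' f'D /and3P[/eqP rf f1 f2]].
  case: (ltngtP (y (u e)) (y (u f))) => [lt|lt|/yI //].
    by have := rep_mono e f' eD f'D; rewrite rf => /(_ lt); rewrite /u in e2 *; lia.
  by have := rep_mono f e' fD e'D; rewrite re => /(_ lt); rewrite /u in f2 *; lia.
(* Otherwise keep only some runs, so that no [x 2 f] lies within a run that gets
   contracted; [q e] is the run to be avoided by [e], if any. *)
pose q e := if [pick f in Dp | (u f != u e) && inrun f (x 2 e)] is Some f then u f else u e.
have [c cP] := directed_cut (Dp :\: D1) u q.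
set D2 := [set e in _ | _] in cP.
have c2 : #|D2| <= path_density k l * (2 * #|x 0 @: D| + #|x l.+2 @: D|).
  have D2P e : e \in D2 ->
      [/\ e \in Dp, ~~ inrun e (x 2 e), c (u e) & (q e == u e) || ~~ c (q e)].
    by rewrite !inE => /andP[/andP[nr /andP[eD ep]] /andP[-> ->]]; split=> //;
       move: nr; rewrite eD ep.
  apply: step; first by apply/subsetP => e /D2P[].
  move=> e f eD2 fD2 pE.
  have [E|ne] := eqVneq (u e) (u f); first by rewrite E crossing_shared.
  (* No kept [x 2 h] is swept over when [x 1 g] moves to [u g]. Within one run this is what removing
     [D1] ensures; for two runs, [u g] would be [q h], which the cut [c] excludes. *)
  have out g h : g \in D2 -> h \in D2 -> ~~ (y (x 1 g) <= y (x 2 h) <= y (u g)).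
    move=> /D2P[gD gr cg _] /D2P[hD hr ch qh]; apply/negP => b.
    have gin : inrun g (x 2 h) by apply/exists_inP; exists g => //; rewrite eqxx.
    have [ugh|ugh] := eqVneq (u g) (u h).
      case/negP: hr; apply/exists_inP; exists g => //.
      by rewrite (repI _ _ gD hD ugh) eqxx -ugh.
    move: qh; rewrite /q; case: pickP => [f' /andP[f'D /andP[f'h f'in]]|].
      by rewrite (inrun_uniq f' g (x 2 h)) // cg (negbTE ugh).
    by move/(_ g); rewrite gD ugh gin.
  have [eD _ _ _] := D2P e eD2; have [fD _ _ _] := D2P f fD2.
  have [_ _ eu] := rep1 e eD; have [_ _ fu] := rep1 f fD.
  apply: contra (bp_noncrossing bp (isT : 1 <= l.+1) eD fD pE).
  by apply: crossing_contract (rep_mono e f eD fD) (rep_mono f e fD eD) _ _ _ _ => //;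
     apply: out.
(* The factor 10 is 5 times 2: [Dp] has at most [#|D1| + 4 * #|D2|] elements, and there are at most
   twice as many runs as starts. *)
have := cardsID D1 Dp; rewrite (setIidPr s1).
move: c1 c2 cP; rewrite -/Dp; move: (path_density k l) => d.
have : d * (2 * #|x 0 @: D| + #|x l.+2 @: D|) <= d * (2 * (#|x 0 @: D| + #|x l.+2 @: D|)).
  by rewrite leq_mul2l mulnDr leq_add2l mul2n -addnn leq_addr orbT.
rewrite mulnCA -mulnA; move: (d * (_ + #|_ @: D|)) (d * _) => M N.
lia.
Qed.
End PathSystems.

(** * Systems of internally disjoint paths in a stack layout *)

Record stack_layout (T : finType) (G : rel T) (k : nat) (rk : T -> nat)
    (pg : T -> T -> nat) : Prop := {
  layout_inj : injective rk;
  layout_pgC : forall x y, pg x y = pg y x;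
  layout_lt : forall x y, G x y -> pg x y < k;
  layout_noncrossing : forall x y z w, G x y -> G z w -> pg x y = pg z w ->
    ~ [/\ rk x < rk z, rk z < rk y & rk y < rk w] }.

Section Systems.
Variables (V : finType) (G : rel V).
Hypothesis symG : symmetric G.

Lemma layout_crossing k rk pg x y z w :
  stack_layout G k rk pg -> G x y -> G z w -> pg x y = pg z w ->
  ~~ crossing (rk x) (rk y) (rk z) (rk w).
Proof.
move=> [_ pgC _ ncr] Gxy Gzw pE; apply/negP => /and3P.
have [xy|yx] := leqP (rk x) (rk y); have [zw|wz] := leqP (rk z) (rk w).
- exact: ncr pE.
- by apply: (ncr x y w z); rewrite // 1?(symG w) // (pgC w).
- by apply: (ncr y x z w); rewrite // 1?(symG y) // (pgC y).
- by apply: (ncr y x w z); rewrite // 1?(symG y) 1?(symG w) // (pgC y) (pgC w).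
Qed.

(* A path is stored as its start, its at most [L] inner vertices, and its end. *)
Definition tpath (L : nat) := (V * L.-bseq V * V)%type.

(** These are the [T]-paths of graph theory; [uniq] makes the two ends distinct. *)
Definition is_tpath (T : {set V}) (a : V) (m : seq V) (b : V) : bool :=
  [&& path G a (rcons m b), uniq (a :: rcons m b), a \in T, b \in T & all [predC T] m].

Definition tsystem L (T : {set V}) (D : {set tpath L}) : bool :=
  [forall p in D, is_tpath T p.1.1 p.1.2 p.2] &&
  [forall p in D, forall q in D, (p != q) ==>
     (~~ has (mem p.1.2) q.1.2 && ((p.1.1, p.2) != (q.1.1, q.2)))].

(** [L.+1] counts the possible numbers of inner vertices, and 2 stands for the set of starts and the
    set of ends, both inside [T]. *)
Definition tdensity (k L : nat) : nat := L.+1 * (path_density k L * 2).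

Lemma tsystemP L (T : {set V}) (D : {set tpath L}) :
  reflect [/\ {in D, forall p : tpath L, is_tpath T p.1.1 p.1.2 p.2},
    {in D &, forall (p q : tpath L) z, z \in p.1.2 -> z \in q.1.2 -> p = q} &
    {in D &, forall p q : tpath L, p.1.1 = q.1.1 -> p.2 = q.2 -> p = q}] (tsystem T D).
Proof.
apply: (iffP andP) => [[/forall_inP tP /forall_inP dP]|[tP dP eP]]; split=> //.
- move=> p q pD qD z zp zq; apply/eqP; apply: contraT => pq.
  move: (dP p pD) => /forall_inP /(_ q qD); rewrite pq => /andP[/hasPn /(_ z zq)].
  by rewrite /= zp.
- move=> p q pD qD e1 e2; apply/eqP; apply: contraT => pq.
  move: (dP p pD) => /forall_inP /(_ q qD); rewrite pq => /andP[_].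
  by rewrite e1 e2 eqxx.
- exact/forall_inP.
- apply/forall_inP => p pD; apply/forall_inP => q qD; apply/implyP => pq; apply/andP; split.
    apply/hasPn => z zq; apply/negP => zp; case/eqP: pq; exact: dP zp zq.
  by apply: contra pq => /eqP[e1 e2]; apply/eqP/eP.
Qed.

(** The members with a given number of inner vertices satisfy [book_paths]: inner vertices lie
    outside [T] and ends in [T], so different positions on different members cannot clash. *)
Lemma card_tsystem k rk pg L (T : {set V}) (D : {set tpath L}) :
  stack_layout G k rk pg -> tsystem T D -> #|D| <= tdensity k L * #|T|.
Proof.
move=> lay /tsystemP[tP dP eP].
have mono l : l < L.+1 -> path_density k l <= path_density k L.
  case: k {lay} => [|k] lL; first by rewrite /path_density !muln0.
  by rewrite leq_mul2l leq_pexp2l ?orbT //; lia.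
rewrite /tdensity -(mulnA L.+1) -(mulnA (path_density k L)).
apply: (card_le_classes (h := fun p : tpath L => size p.1.2)) => [p _|l lL].
  by rewrite ltnS size_bseq.
set Dl := [set p in D | _].
pose x i (p : tpath L) := nth p.1.1 (p.1.1 :: rcons p.1.2 p.2) i.
have DlP p : p \in Dl -> [/\ p \in D, size p.1.2 = l & is_tpath T p.1.1 p.1.2 p.2].
  by rewrite inE => /andP[pD /eqP]; split=> //; exact: tP.
have xin i p : p \in Dl -> 0 < i <= l -> x i p \in (p.1.2 : seq V).
  move=> /DlP[_ sz _]; case: i => // i /andP[_ il]; rewrite /x /= nth_rcons sz il.
  by rewrite mem_nth // sz.
have xl p : p \in Dl -> x l.+1 p = p.2.
  by move=> /DlP[_ sz _]; rewrite /x /= nth_rcons sz ltnn eqxx.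
have xG i p : p \in Dl -> i <= l -> G (x i p) (x i.+1 p).
  move=> /DlP[_ sz /and5P[/pathP Gp _ _ _ _]] il.
  by apply: (Gp p.1.1); rewrite size_rcons sz.
have minT p z : p \in Dl -> z \in (p.1.2 : seq V) -> z \notin T.
  by move=> /DlP[_ _ /and5P[_ _ _ _ /allP nT]] /nT.
have bp : book_paths rk k l x (fun i p => pg (x i p) (x i.+1 p)) Dl.
  split.
  - by move=> i il p pD; apply: (layout_lt lay); apply: xG.
  - by move=> i il p q pD qD; apply: layout_crossing lay _ _; exact: xG.
  - move=> i il p q pD qD xE; have [pD' _ _] := DlP p pD; have [qD' _ _] := DlP q qD.
    apply: (dP _ _ pD' qD' (x i p)); first exact: xin.
    by rewrite xE; exact: xin.
  - move=> i il p q pD qD; have [<- _|pq] := eqVneq p q.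
      have [_ sz /and5P[_ up _ _ _]] := DlP p pD.
      rewrite /x -[nth _ (_ :: _) i.+1]/(nth p.1.1 (p.1.1 :: rcons p.1.2 p.2) i.+1).
      by rewrite nth_uniq //= ?size_rcons ?sz; lia.
    rewrite orbF => l0; apply/eqP => xE.
    have [pD' _ /and5P[_ _ aT _ _]] := DlP p pD.
    have [qD' _ /and5P[_ _ _ bT _]] := DlP q qD.
    case: i il xE => [|i] il xE.
      by have := minT q _ qD (xin 1 q qD l0); rewrite -xE aT.
    have xp := xin i.+1 p pD il.
    have [ll|] := ltnP i.+1 l.
      by case/eqP: pq; apply: dP xp _ => //; rewrite xE; apply: xin.
    move=> li; have il' : i.+1 = l by lia.
    by have := minT p _ pD xp; rewrite xE il' (xl q qD) bT.
  - move=> p q pD qD x0E; rewrite !xl // => pqE.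
    have [pD' _ _] := DlP p pD; have [qD' _ _] := DlP q qD; exact: eP.
apply: leq_trans (card_book_paths (layout_inj lay) bp) _.
apply: leq_mul.
  exact: mono.
rewrite mul2n -addnn; apply: leq_add; apply/subset_leq_card/subsetP => _ /imsetP[p pD ->].
  by have [_ _ /and5P[_ _ aT _ _]] := DlP p pD.
by rewrite xl //; have [_ _ /and5P[_ _ _ bT _]] := DlP p pD.
Qed.
End Systems.

(** * Hitting short walks *)

Lemma card_bigcup_le (I T : finType) (R : {set I}) (N : I -> {set T}) b :
  {in R, forall v, #|N v| <= b} -> #|\bigcup_(v in R) N v| <= #|R| * b.
Proof.
move=> Nb; apply: leq_trans (_ : \sum_(v in R) #|N v| <= _).
  elim/big_rec2: _ => [|v n A _ An]; first by rewrite cards0.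
  by apply: leq_trans (leq_card_setU _ _) _; rewrite leq_add2l.
by rewrite -sum_nat_const; apply: leq_sum.
Qed.

(** View [P] as the edges of a sparse multigraph. At least half of [S] has degree at most [4 * d].
    Take a maximal independent set [R] among these vertices: each of them is in [R] or adjacent to
    it, and a vertex of [R] accounts for at most [1 + 8 * d] of them. *)
Lemma sparse_independent_set (I V : finType) (P : {set I}) (s t : I -> V)
    (S : {set V}) d :
  #|P| <= d * #|S| ->
  exists R : {set V}, [/\ R \subset S, #|S| <= 2 * (1 + 8 * d) * #|R| &
    {in P, forall p, s p \in R -> t p \in R -> s p = t p}].
Proof.
move=> Pd; pose inc v := [set p in P | (s p == v) || (t p == v)].
pose S0 := [set v in S | #|inc v| <= 4 * d].
pose indep (R : {set V}) := (R \subset S0) &&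
  [forall p in P, (s p \in R) ==> (t p \in R) ==> (s p == t p)].
have [R /maxsetP[/andP[RS /forall_inP Ri] Rmax]] : {R | maxset indep R}.
  apply: ex_maxset; exists set0; rewrite /indep sub0set /=.
  by apply/forall_inP => p _; rewrite inE.
exists R; split.
- by apply: subset_trans RS _; apply/subsetP => v; rewrite inE => /andP[].
- have degsum : \sum_(v in S :\: S0) #|inc v| <= 2 * #|P|.
    apply: leq_trans (_ : \sum_(v : V) #|inc v| <= _).
      by rewrite [X in _ <= X](bigID (mem (S :\: S0))) /= leq_addr.
    have incE v : #|inc v| = \sum_(p in P) ((s p == v) || (t p == v) : nat).
      rewrite -sum1_card big_mkcond [RHS]big_mkcond; apply: eq_bigr => p _.
      by rewrite inE; case: (p \in P); case: (_ || _).
    rewrite (eq_bigr _ (fun v _ => incE v)) exchange_big /= mulnC -sum_nat_const.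
    apply: leq_sum => p _.
    apply: leq_trans (_ : \sum_(v : V) ((v == s p : nat) + (v == t p : nat)) <= _).
      by apply: leq_sum => v _; rewrite !(eq_sym v); case: (s p == v); case: (t p == v).
    by rewrite big_split /= -!big_mkcond /= !big_pred1_eq.
  have few : (4 * d).+1 * #|S :\: S0| <= 2 * (d * #|S|).
    apply: leq_trans (_ : 2 * #|P| <= _); last by rewrite leq_mul2l Pd.
    apply: leq_trans degsum; rewrite mulnC -sum_nat_const; apply: leq_sum => v.
    by rewrite !inE => /andP[+ vS]; rewrite vS /= -ltnNge.
  pose N v := v |: (s @: inc v :|: t @: inc v).
  have cover : #|S0| <= #|R| * (1 + 8 * d).
    apply: leq_trans (_ : #|\bigcup_(v in R) N v| <= _).
      apply/subset_leq_card/subsetP => w wS.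
      have [wR|wR] := boolP (w \in R).
        by apply/bigcupP; exists w; rewrite // /N setU11.
      have : ~~ indep (w |: R).
        apply: contra wR => wRi; rewrite -(Rmax _ wRi (subsetUr _ _)); exact: setU11.
      rewrite /indep subUset sub1set wS RS /= => /forall_inPn[p pP].
      rewrite !negb_imply => /and3P[spR tpR st].
      have [spR'|spR'] := boolP (s p \in R).
        have tw : t p = w.
          move: tpR; rewrite in_setU1 => /orP[/eqP //|tpR].
          by move: (Ri p pP); rewrite spR' tpR (negbTE st).
        apply/bigcupP; exists (s p) => //; rewrite /N -tw !in_setU; apply/orP; right; apply/orP.
        by right; apply: imset_f; rewrite inE pP eqxx.
      have sw : s p = w by move: spR; rewrite in_setU1 (negbTE spR') orbF => /eqP.
      have tpR' : t p \in R.
        move: tpR; rewrite in_setU1 => /orP[/eqP tw|//]; by rewrite sw tw eqxx in st.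
      apply/bigcupP; exists (t p) => //; rewrite /N -sw !in_setU; apply/orP; right; apply/orP.
      by left; apply: imset_f; rewrite inE pP eqxx orbT.
    apply: card_bigcup_le => v /(subsetP RS); rewrite inE => /andP[_ vd].
    rewrite /N; apply: leq_trans (leq_card_setU _ _) _; rewrite cards1 leq_add2l.
    apply: leq_trans (leq_card_setU _ _) _.
    have := leq_imset_card s (mem (inc v)); have := leq_imset_card t (mem (inc v)).
    move=> h1 h2; apply: leq_trans (leq_add h2 h1) _.
    by rewrite (_ : 8 * d = 4 * d + 4 * d); [exact: (leq_add vd vd)|lia].
  have := cardsID S0 S; have /setIidPr -> : S0 \subset S.
    by apply/subsetP => v; rewrite inE => /andP[].
  move: few cover; move: #|S0| #|S :\: S0| #|S| #|R| => a b c e few cover abc.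
  have : 2 * b <= c by rewrite leqNgt; apply/negP => cb; nia.
  nia.
- by move=> p pP sR tR; move: (Ri p pP); rewrite sR tR => /eqP.
Qed.

Section Hitting.
Variables (V : finType) (G : rel V).
Hypothesis symG : symmetric G.

(** A path from [R] that violates both alternatives could be added to a maximal system. *)
Lemma maximal_tsystem L (T R : {set V}) :
  exists D : {set tpath V L}, [/\ tsystem G T D, {in D, forall p : tpath V L, p.1.1 \in R} &
    forall a m b, a \in R -> size m <= L -> is_tpath G T a m b ->
      (exists2 q, q \in D & q.1.1 = a /\ q.2 = b) \/
      (exists2 q, q \in D & exists2 z, z \in (q.1.2 : seq V) & z \in m)].
Proof.
pose P (D : {set tpath V L}) := tsystem G T D && [forall p in D, p.1.1 \in R].
have [D /maxsetP[/andP[DT /forall_inP DR] Dmax]] : {D | maxset P D}.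
  apply: ex_maxset; exists set0; rewrite /P; apply/andP; split.
    by apply/tsystemP; split=> p; rewrite inE.
  by apply/forall_inP => p; rewrite inE.
exists D; split=> // a m b aR mL amb.
pose p : tpath V L := (a, Bseq mL, b).
have [pD|pD] := boolP (p \in D); first by left; exists p.
have /negP nP : ~~ P (p |: D).
  apply: contra pD => pDP; rewrite -(Dmax _ pDP (subsetUr _ _)); exact: setU11.
have [/existsP[q /and3P[qD /eqP qa /eqP qb]]|nends] :=
    boolP [exists q : tpath V L, [&& q \in D, q.1.1 == a & q.2 == b]].
  by left; exists q.
have [/existsP[q /andP[qD /hasP[z zm zq]]]|nshare] :=
    boolP [exists q : tpath V L, (q \in D) && has (mem (q.1.2 : seq V)) m].
  by right; exists q => //; exists z.
case: nP; apply/andP; split; last first.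
  by apply/forall_inP => q /setU1P[->|/DR].
have /tsystemP[tD dD eD] := DT.
have ends q : q \in D -> q.1.1 = a -> q.2 = b -> False.
  by move=> qD qa qb; case/existsP: nends; exists q; rewrite qD qa qb !eqxx.
have share q z : q \in D -> z \in (q.1.2 : seq V) -> z \in m -> False.
  move=> qD zq zm; case/existsP: nshare; exists q; rewrite qD /=.
  by apply/hasP; exists z.
apply/tsystemP; split.
- by move=> q /setU1P[->//|/tD].
- move=> q q' /setU1P[->|qD] /setU1P[->|q'D] z zq zq' //.
  + by case: (share q' z).
  + by case: (share q z).
  + exact: dD zq zq'.
- move=> q q' /setU1P[->|qD] /setU1P[->|q'D] e1 e2 //.
  + by case: (ends q').
  + by case: (ends q).
  + exact: eD.
Qed.

(** Shorten the walk to a simple path and stop at its first return to [T]. *)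
Lemma walk_tpath (T : {set V}) a s :
  path G a s -> a \in T -> last a s \in T -> last a s != a ->
  exists m b, [/\ is_tpath G T a m b, {subset rcons m b <= s} & size m < size s].
Proof.
move=> + aT; case/shortenP => s' Gs' us' ss' lT la.
have hT : has (mem T) s'.
  apply/hasP; exists (last a s') => //; case: s' {Gs' us' ss' lT} la => [|c s'] /=.
    by rewrite eqxx.
  by rewrite mem_last.
have ss : size s' <= size s by apply: uniq_leq_size => //; case/andP: us'.
move: Gs' us' ss' ss {lT la}; case: (split_find hT) => b m m2 bT mT.
rewrite cat_path => /andP[Gm _]; rewrite -cat_cons cat_uniq => /andP[um _] ss' ss.
exists m, b; split.
- rewrite /= in bT; rewrite /is_tpath Gm um aT bT /=.
  by rewrite (eq_all (a2 := predC (mem T))) // all_predC.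
- by move=> z zm; apply: ss'; rewrite mem_cat zm.
- by apply: leq_trans ss; rewrite size_cat size_rcons leq_addr.
Qed.

Lemma path_rev_rcons a n z : path G a (rcons n z) -> path G z (rcons (rev n) a).
Proof.
rewrite -(rev_path _ a) last_rcons belast_rcons rev_cons.
by rewrite (eq_path (e' := G)) // => x y /=; rewrite symG.
Qed.

(** The factors bound in turn [Q] against [T], [T] against [S], [S] against [R], and the vertices
    other than the start on one path of [Q], for the sets in the proof of [hitting_set]. *)
Definition hitting_bound (k r : nat) : nat :=
  tdensity k r * (1 + 2 * r * tdensity k (2 * r)) *
  (2 * (1 + 8 * tdensity k (2 * r))) * r.+1.

(** [P] is a maximal system of [S]-paths, [R] a large part of [S] with no member of [P] between two
    of its vertices, and [T] is [S] with the inner vertices of [P]. Some [v] in [R] starts few paths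
    of a maximal system [Q] of [T]-paths from [R]; their other vertices form [H]. A walk avoiding
    [H] would meet a path of [Q] from another vertex of [R], and joining the two contradicts the
    maximality of [P]. *)
Lemma hitting_set k rk pg r (S : {set V}) :
  stack_layout G k rk pg -> S != set0 ->
  exists2 v, v \in S & exists H : {set V}, [/\ v \notin H, #|H| <= hitting_bound k r &
    forall s, path G v s -> size s <= r -> last v s \in S -> last v s != v ->
      has (mem H) s].
Proof.
move=> lay S0; rewrite -card_gt0 in S0.
have [P [PT _ Pmax]] := maximal_tsystem (2 * r) S S.
have Pcard := card_tsystem symG lay PT.
have [R [RS SR Ri]] :=
  sparse_independent_set (fun p : tpath V (2 * r) => p.1.1) (fun p : tpath V (2 * r) => p.2) Pcard.
move: Pcard SR; set d := tdensity k (2 * r) => Pcard SR.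
pose M := \bigcup_(p in P) [set z in (p.1.2 : seq V)].
pose T := S :|: M.
have Mcard : #|M| <= d * #|S| * (2 * r).
  apply: leq_trans (_ : #|P| * (2 * r) <= _); last by rewrite leq_mul2r Pcard orbT.
  apply: card_bigcup_le => p _; rewrite cardsE; apply: leq_trans (card_size _) _.
  exact: size_bseq.
have Tcard : #|T| <= (1 + 2 * r * d) * #|S|.
  apply: leq_trans (leq_card_setU _ _) _; rewrite mulnDl mul1n leq_add2l.
  by apply: leq_trans Mcard _; rewrite mulnC mulnA.
have [Q [QT QR Qmax]] := maximal_tsystem r T R.
have Qcard := card_tsystem symG lay QT.
pose q := tdensity k r * (1 + 2 * r * d) * (2 * (1 + 8 * d)).
have Qq : #|Q| <= q * #|R|.
  have mul4 a b c e : a * b * c * e = a * (b * (c * e)) by rewrite !mulnA.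
  apply: leq_trans Qcard _; rewrite /q mul4 leq_mul2l; apply/orP; right.
  by apply: leq_trans Tcard _; rewrite leq_mul2l SR orbT.
have [v vR vq] : exists2 v, v \in R & #|[set p in Q | p.1.1 == v]| <= q.
  have [/exists_inP[v vR vq]|/exists_inPn none] :=
    boolP [exists v in R, #|[set p in Q | p.1.1 == v]| <= q]; first by exists v.
  have R0 : 0 < #|R| by rewrite lt0n; apply/eqP => R0; rewrite R0 muln0 in SR; lia.
  have : #|R| * q.+1 <= #|Q|.
    rewrite -sum_nat_const.
    apply: leq_trans (_ : \sum_(v in R) #|[set p in Q | p.1.1 == v]| <= _).
      by apply: leq_sum => v /none; rewrite -ltnNge.
    rewrite -[X in _ <= X]sum1_card (partition_big (fun p : tpath V r => p.1.1) (mem R)) //=.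
    apply: leq_sum => v _; rewrite -sum1_card; apply/eq_leq/eq_bigl => p.
    by rewrite inE.
  move=> /leq_trans /(_ Qq).
  by rewrite mulnS [#|R| * q]mulnC -[leqRHS]add0n leq_add2r leqNgt R0.
have vS := subsetP RS v vR.
have vT : v \in T by rewrite inE vS.
pose H := \bigcup_(p in [set p in Q | p.1.1 == v]) (p.2 |: [set z in (p.1.2 : seq V)]).
have /tsystemP[QP Qd Qe] := QT; have /tsystemP[PP Pd Pe] := PT.
exists v => //; exists H; split.
- apply/bigcupP => -[p]; rewrite inE => /andP[pQ /eqP pv].
  have /and3P[_ + _] := QP p pQ; rewrite pv /= mem_rcons inE => /andP[/norP[vb vm] _].
  by rewrite !inE (negbTE vb) (negbTE vm).
- apply: leq_trans (_ : #|[set p in Q | p.1.1 == v]| * r.+1 <= _); last first.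
    by rewrite /hitting_bound leq_mul2r vq orbT.
  apply: card_bigcup_le => p _; apply: leq_trans (leq_card_setU _ _) _.
  rewrite cards1 add1n ltnS cardsE; apply: leq_trans (card_size _) _; exact: size_bseq.
move=> s Gs sr lS lv; apply: contraT => /hasPn sH.
have lT : last v s \in T by rewrite inE lS.
have [m [b [vmb mbs ms]]] := walk_tpath Gs vT lT lv.
have mr : size m <= r by exact: ltnW (leq_trans ms sr).
have [[p pQ [pv pb]]|[p pQ [z zp zm]]] := Qmax v m b vR mr vmb.
  have := sH b; rewrite mbs ?mem_rcons ?mem_head // => /(_ isT) /negP; case.
  by apply/bigcupP; exists p; rewrite ?inE ?pQ ?pv ?pb ?eqxx.
have [pv|pv] := eqVneq p.1.1 v.
  have := sH z; rewrite mbs ?mem_rcons ?inE ?zm ?orbT // => /(_ isT) /negP; case.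
  by apply/bigcupP; exists p; rewrite ?inE ?pQ ?pv ?eqxx ?zp ?orbT.
have pR : p.1.1 \in R by exact: QR.
have /and5P[Gp _ _ _ pT] := QP p pQ; have /and5P[Gm _ _ _ mT] := vmb.
have pr := size_bseq p.1.2.
move: zp Gp pT pr; move: (bseqval p.1.2) => n zn; case/splitPr: zn => n1 n2 Gn nT nr.
case/splitPr: zm Gm mT mr {vmb mbs ms} => m1 m2 Gm mT mr.
(* Follow the walk from [v] to the common vertex [z], then the path of [Q] back to its start. Both
   parts have inner vertices outside [T]. *)
pose w := rcons m1 z ++ rcons (rev n1) p.1.1.
have Gw : path G v w.
  rewrite cat_path last_rcons; apply/andP; split.
    by move: Gm; rewrite rcons_cat -cat_rcons cat_path => /andP[].
  apply: path_rev_rcons.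
  by move: Gn; rewrite rcons_cat -cat_rcons cat_path => /andP[].
have wT y : y \in w -> y \in T -> y = p.1.1.
  move=> + yT; rewrite mem_cat !mem_rcons !inE mem_rev => yw.
  have ym : y \notin m1 ++ z :: m2 by apply/negP => /(allP mT); rewrite /= yT.
  have yn : y \notin n1 ++ z :: n2 by apply/negP => /(allP nT); rewrite /= yT.
  move: yw ym yn; rewrite !mem_cat !inE.
  by case: (y == z); case: (y \in m1); case: (y \in n1); rewrite ?orbT //= orbF => /eqP.
have pS : p.1.1 \in S by exact: (subsetP RS).
have lw : last v w = p.1.1 by rewrite last_cat last_rcons.
have lwT : last v w \in T by rewrite lw inE pS.
have lwv : last v w != v by rewrite lw.
have [m' [b' [vmb' mbs' ms']]] := walk_tpath Gw vT lwT lwv.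
have /and5P[Gm' um' _ bT' mT'] := vmb'.
have bE : b' = p.1.1.
  by apply: wT => //; apply: mbs'; rewrite mem_rcons mem_head.
have vmS : is_tpath G S v m' p.1.1.
  apply/and5P; split=> //; rewrite -?bE //.
  by apply: sub_all mT' => y; rewrite /= inE => /norP[].
have mr' : size m' <= 2 * r.
  move: ms' mr nr; rewrite /w !size_cat !size_rcons size_rev /=.
  by move: (size m') (size m1) (size m2) (size n1) (size n2); clear; lia.
have [[p' pP [pv' pb']]|[p' pP [y yp ym]]] := Pmax v m' p.1.1 vS mr' vmS.
  by move: (Ri p' pP); rewrite pv' pb' => /(_ vR pR) E; rewrite E eqxx in pv.
(* A shared inner vertex [y] would lie in [M], hence in [T], which [m'] avoids. *)
move/allP: mT' => /(_ y ym) /=; rewrite inE negb_or => /andP[_ /bigcupP[]].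
by exists p' => //; rewrite inE.
Qed.
End Hitting.

(** * Weak reachability *)

Section Reach.
Variables (V : finType) (G : rel V).

(** Ranks are given out from the top: when [v] is removed from [S], the vertices of [S] with smaller
    rank are exactly the others, so the hitting set for [S] serves [v]. *)
Lemma hitting_order r b :
  (forall S : {set V}, S != set0 -> exists2 v, v \in S & exists H : {set V},
    [/\ v \notin H, #|H| <= b & forall s, path G v s -> size s <= r ->
      last v s \in S -> last v s != v -> has (mem H) s]) ->
  exists (pi : V -> nat) (H : V -> {set V}), injective pi /\
    forall v, [/\ v \notin H v, #|H v| <= b & forall s, path G v s -> size s <= r ->
      pi (last v s) < pi v -> has (mem (H v)) s].
Proof.
move=> hit.
suff main n (S : {set V}) : #|S| = n -> exists (pi : V -> nat) (H : V -> {set V}),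
    [/\ {in S &, injective pi}, {in S, forall v, pi v < n} &
     {in S, forall v, [/\ v \notin H v, #|H v| <= b & forall s, path G v s -> size s <= r ->
      last v s \in S -> pi (last v s) < pi v -> has (mem (H v)) s]}].
  have [pi [H [piI _ HP]]] := main _ [set: V] erefl.
  exists pi, H; split=> [u v|v]; first by apply: piI; rewrite inE.
  have [|h1 h2 h3] := HP v; first by rewrite inE.
  by split=> // s sG sr; apply: h3; rewrite ?inE.
elim: n S => [|n IH] S Sn.
  exists (fun=> 0), (fun=> set0); have -> : S = set0 by apply/eqP; rewrite -cards_eq0 Sn.
  by split=> v; rewrite inE.
have S0 : S != set0 by rewrite -card_gt0 Sn.
have [v vS [Hv [vH Hvb hv]]] := hit S S0.
have [pi [H [piI pin HP]]] := IH (S :\ v) ltac:(by move: (cardsD1 v S); rewrite vS Sn; lia).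
exists (fun u => if u == v then n else pi u), (fun u => if u == v then Hv else H u).
have mem u : u \in S -> u != v -> u \in S :\ v by move=> uS uv; rewrite !inE uv.
split.
- move=> u w uS wS; have [->|uv] := eqVneq u v; have [->|wv] := eqVneq w v => //.
  + by move=> E; have := pin w (mem w wS wv); rewrite -E ltnn.
  + by move=> E; have := pin u (mem u uS uv); rewrite E ltnn.
  + by apply: piI; exact: mem.
- by move=> u uS; case: eqVneq => [//|uv]; exact: ltnW (pin u (mem u uS uv)).
- move=> u uS; have [->|uv] := eqVneq u v.
    rewrite ?eqxx; split=> // s sG sr lS; case: eqVneq => [_|lv _]; first by rewrite ltnn.
    exact: hv.
  have [h1 h2 h3] := HP u (mem u uS uv); split=> // s sG sr lS.
  case: eqVneq => [_|lv]; last by apply: h3 => //; exact: mem.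
  by have := pin u (mem u uS uv); lia.
Qed.

Variable pi : V -> nat.

(** [walk n (pi w) v w] says that [w] is weakly [n]-reachable from [v]. *)
Definition walk (n lo : nat) (a b : V) : Prop :=
  exists s, [/\ path G a s, last a s = b, size s <= n & all (fun x => lo <= pi x) (a :: s)].

(** This is the geometric sum [1 + b + ... + b ^ n]. *)
Fixpoint reach_bound (b n : nat) : nat :=
  if n is n'.+1 then 1 + b * reach_bound b n' else 1.

(** A walk from [v] to a weakly reachable [w] other than [v] ends below [v], so it passes through
    some [g] in [H v]; its rest is a shorter walk that shows [w] to be weakly reachable from [g]. *)
Lemma card_reach r b (H : V -> {set V}) :
  injective pi ->
  (forall v, [/\ v \notin H v, #|H v| <= b & forall s, path G v s -> size s <= r ->
      pi (last v s) < pi v -> has (mem (H v)) s]) ->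
  forall n, n <= r -> exists W : V -> {set V},
    forall v, #|W v| <= reach_bound b n /\ forall w, walk n (pi w) v w -> w \in W v.
Proof.
move=> piI HP; elim=> [|n IH] nr.
  exists (fun v => [set v]) => v; rewrite cards1; split=> // w [s [_ lw]].
  by rewrite leqn0 size_eq0 => /eqP s0; rewrite -lw s0 inE.
have [W WP] := IH (ltnW nr).
exists (fun v => v |: \bigcup_(g in H v) W g) => v; split.
  apply: leq_trans (leq_card_setU _ _) _; rewrite cards1 leq_add2l.
  have [_ Hb _] := HP v; apply: leq_trans (_ : #|H v| * reach_bound b n <= _).
    by apply: card_bigcup_le => g _; case: (WP g).
  by rewrite leq_mul2r Hb orbT.
move=> w [s [sG lw sn sw]]; have [->|wv] := eqVneq w v; first exact: setU11.
have wlt : pi w < pi v.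
  rewrite ltn_neqAle; case/andP: sw => -> _; rewrite andbT.
  by apply: contraNneq wv => /piI ->.
have [_ _ hit] := HP v.
have /hasP[g gs gH] : has (mem (H v)) s.
  by apply: hit; rewrite ?lw //; exact: leq_trans nr.
apply/setU1P; right; apply/bigcupP; exists g => //.
have [_ Wg] := WP g; apply: Wg.
case/splitPr: gs sG lw sn sw => s1 s2; rewrite cat_path last_cat size_cat /=.
rewrite all_cat => /andP[_ /andP[_ s2G]] lw sn /and3P[_ _ s2w].
by exists s2; split=> //; lia.
Qed.

(** Colour in increasing order of [pi]: each [W v] blocks at most [b] of the [b.+1] colours. *)
Lemma greedy_colouring b (W : V -> {set V}) :
  (forall v, #|W v| <= b) ->
  exists phi : V -> 'I_b.+1, forall v w, w \in W v -> pi w < pi v -> phi w != phi v.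
Proof.
move=> Wb.
suff main n : exists phi : V -> 'I_b.+1,
    forall v w, pi v < n -> w \in W v -> pi w < pi v -> phi w != phi v.
  have [phi phiP] := main (\max_v (pi v)).+1; exists phi => v w; apply: phiP.
  exact: (leq_bigmax v).
elim: n => [|n [phi phiP]]; first by exists (fun=> ord0).
have free v : exists c, c \notin phi @: W v.
  have [/existsP //|/existsPn full] := boolP [exists c, c \notin phi @: W v].
  have : #|'I_b.+1| <= #|phi @: W v|.
    by apply/subset_leq_card/subsetP => c _; have := full c; rewrite negbK.
  move=> h; have := leq_trans h (leq_imset_card phi _); rewrite card_ord.
  by move=> /leq_trans /(_ (Wb v)); rewrite ltnn.
exists (fun v => if pi v == n then xchoose (free v) else phi v) => v w.
rewrite ltnS leq_eqVlt => /orP[/eqP vn|vn] wW wv; last first.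
  by rewrite (ltn_eqF vn) (ltn_eqF (ltn_trans wv vn)); exact: phiP.
rewrite vn eqxx (ltn_eqF (leq_trans wv _)) ?vn //.
apply: contraNneq (xchooseP (free v)) => <-; exact: imset_f.
Qed.

End Reach.

Definition colour_bound (k r : nat) : nat := (reach_bound (hitting_bound k r) r).+1.

Theorem stack_layout_colouring (V : finType) (G : rel V) k rk pg r :
  symmetric G -> stack_layout G k rk pg ->
  exists (pi : V -> nat) (phi : V -> 'I_(colour_bound k r)), injective pi /\
    forall v w, walk G pi r (pi w) v w -> phi v = phi w -> v = w.
Proof.
move=> symG lay.
have [pi [H [piI HP]]] := hitting_order (fun S S0 => hitting_set symG r lay S0).
have [W WP] := card_reach piI HP (leqnn r).
have [phi phiP] := greedy_colouring pi (fun v => (WP v).1).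
exists pi, phi; split=> // v w vw E; apply/eqP; apply: contraT => nvw.
have wlt : pi w < pi v.
  case: vw => s [_ _ _ /andP[le _]]; rewrite ltn_neqAle le andbT.
  by apply: contraNneq nvw => /piI ->.
by have := phiP v w ((WP v).2 w vw) wlt; rewrite E eqxx.
Qed.

(** * Dimension *)

Section Realizer.
Import Order.TTheory.
Local Open Scope order_scope.
Variables (d : Order.disp_t) (P : finPOrderType d) (C : finType) (sig : P -> P -> C).

(** An alternating cycle is replaced by a set in which each pair has a successor and a predecessor;
    following successors in such a finite set closes up to a cycle. *)
Hypothesis no_alternating_cycle : forall (c : C) (Z : {set P * P}), Z != finset.set0 ->
  (forall p, p \in Z -> [/\ ~~ (p.1 <= p.2), sig p.1 p.2 = c,
     exists2 q, q \in Z & p.1 <= q.2 & exists2 q, q \in Z & q.1 <= p.2]) -> False.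

Section Class.
Variable c : C.

Let Q : {set P * P} := [set p | ~~ (p.1 <= p.2) && (sig p.1 p.2 == c)]%SET.
Let step (p q : P * P) := [&& p \in Q, q \in Q & p.1 <= q.2].
(* The transitive closure of [<=] together with [y <= x] for all [(x, y)] in [Q]. *)
Let above (u w : P) := (u <= w) ||
  [exists p in Q, exists q in Q, [&& u <= p.2, connect step p q & q.1 <= w]].

Let aboveP u w : reflect (u <= w \/ exists p q,
    [/\ p \in Q, q \in Q, u <= p.2, connect step p q & q.1 <= w]) (above u w).
Proof.
apply: (iffP orP) => -[->|H]; [by left| |by left|]; right.
  have /exists_inP[p pQ /exists_inP[q qQ /and3P[? ? ?]]] := H.
  by exists p, q.
case: H => p [q [pQ qQ h1 h2 h3]].
by apply/exists_inP; exists p => //; apply/exists_inP; exists q => //; rewrite h1 h2.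
Qed.

Let acyclic p q : connect step p q -> step q p -> False.
Proof.
case/connectP => s ps ->{q} qp.
have cyc : cycle step (p :: s) by rewrite /= rcons_path ps.
pose Z := [set t in p :: s]%SET.
have ZE t : (t \in Z) = (t \in p :: s) by rewrite finset.in_set.
apply: (no_alternating_cycle (c := c) (Z := Z)).
  by apply/set0Pn; exists p; rewrite ZE mem_head.
move=> t; rewrite ZE => tc.
have /and3P[tQ _ tn] := next_cycle cyc tc.
have /and3P[_ _ tp] := prev_cycle cyc tc.
move: tQ; rewrite inE => /andP[-> /eqP ->]; split=> //.
  by exists (next (p :: s) t); rewrite // ZE mem_next.
by exists (prev (p :: s) t); rewrite // ZE mem_prev.
Qed.

Let above_trans : transitive above.
Proof.
move=> w u z /aboveP[uw|[p [q [pQ qQ up pq qw]]]] /aboveP[wz|[p' [q' [p'Q q'Q wp' pq' qz]]]];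
  apply/aboveP.
- by left; exact: le_trans wz.
- by right; exists p', q'; split=> //; exact: le_trans wp'.
- by right; exists p, q; split=> //; exact: le_trans wz.
- right; exists p, q'; split=> //; apply: connect_trans pq _.
  apply: connect_trans pq'; apply: connect1.
  by rewrite /step qQ p'Q (le_trans qw).
Qed.

Let above_anti : antisymmetric above.
Proof.
move=> u w /andP[/aboveP[uw|[p [q [pQ qQ up pq qw]]]]
  /aboveP[wu|[p' [q' [p'Q q'Q wp' pq' qu]]]]].
- by apply/le_anti; rewrite uw.
- case: (acyclic pq'); rewrite /step q'Q p'Q /=.
  exact: le_trans qu (le_trans uw wp').
- case: (acyclic pq); rewrite /step qQ pQ /=.
  exact: le_trans qw (le_trans wu up).
- have s1 : step q p' by rewrite /step qQ p'Q (le_trans qw).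
  case: (acyclic (connect_trans pq (connect_trans (connect1 s1) pq'))).
  by rewrite /step q'Q pQ (le_trans qu).
Qed.

(** As [step] is acyclic, [above] is a partial order. Sorting by the size of its principal
    down-sets, with ties broken by the enumeration, extends it linearly. *)
Lemma class_linear_extension : exists L : rel P, linear_extension L /\
  forall x y, ~~ (x <= y) -> sig x y = c -> L y x.
Proof.
pose key u := (#|[set z | above z u]%SET| * #|P| + enum_rank u)%N.
have key_lt u w : above u w -> u != w -> (key u < key w)%N.
  move=> uw nuw; have sub : (#|[set z | above z u]%SET| < #|[set z | above z w]%SET|)%N.
    apply/proper_card/properP; split.
      by apply/fintype.subsetP => z; rewrite !inE => /above_trans; apply.
    exists w; rewrite !inE; first by apply/aboveP; left.
    by apply: contra nuw => wu; apply/eqP/above_anti; rewrite uw.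
  apply: leq_trans (leq_addr _ _); apply: leq_trans (leq_mul sub (leqnn _)).
  by rewrite mulSn [leqRHS]addnC ltn_add2l ltn_ord.
have keyI : injective key.
  move=> z w kzw; apply: enum_rank_inj; apply: val_inj => /=.
  have zN := ltn_ord (enum_rank z); have wN := ltn_ord (enum_rank w).
  by move: kzw => /(congr1 (modn^~ #|P|)); rewrite /key !modnMDl !modn_small.
have key_le u w : above u w -> (key u <= key w)%N.
  by move=> uw; have [->//|/(key_lt _ _ uw)/ltnW] := eqVneq u w.
exists (fun u w => (key u <= key w)%N); split.
  split=> [z|z w|z w u|z w|z w zw].
  - exact: leqnn.
  - by rewrite -eqn_leq => /eqP/keyI.
  - exact: leq_trans.
  - exact: leq_total.
  - by apply: key_le; apply/aboveP; left.
move=> x y xy sxy; apply: key_le; apply/aboveP; right; exists (x, y), (x, y).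
by rewrite inE /= xy sxy eqxx.
Qed.

End Class.

Lemma no_alternating_cycle_realizer : has_realizer P #|C|.
Proof.
have [L LP] := choice class_linear_extension.
exists (fun i => L (enum_val i)); split=> [i|x y]; first by case: (LP (enum_val i)).
split=> [xy i|Lxy].
  by have [[_ _ _ _ ext] _] := LP (enum_val i); exact: ext.
apply: contraT => nxy; have := Lxy (enum_rank (sig x y)); rewrite enum_rankK => L1.
have [[_ anti _ _ _] rev] := LP (sig x y).
have E : x = y by apply: anti; rewrite L1 rev.
by rewrite E lexx in nxy.
Qed.

End Realizer.

Section Walks.
Variables (V : finType) (G : rel V) (pi : V -> nat).

Lemma walk_sym n lo a b : symmetric G -> walk G pi n lo a b -> walk G pi n lo b a.
Proof.
move=> symG [s [Gs <- sn sl]]; exists (rev (belast a s)); split.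
- by rewrite rev_path (eq_path (e' := G)) // => x y /=; rewrite symG.
- by case: s {Gs sn sl} => [//|x s] /=; rewrite rev_cons last_rcons.
- by rewrite size_rev size_belast.
- have -> : last a s :: rev (belast a s) = rev (a :: s).
    by rewrite [in RHS]lastI rev_rcons.
  by rewrite all_rev.
Qed.

Lemma walk_trans n m lo a b c :
  walk G pi n lo a b -> walk G pi m lo b c -> walk G pi (n + m) lo a c.
Proof.
move=> [s [Gs <- sn sl]] [t [Gt <- tm tl]]; exists (s ++ t).
rewrite cat_path last_cat size_cat leq_add // Gs Gt; split=> //.
by rewrite -cat_cons all_cat sl; case/andP: tl.
Qed.

Lemma walk_weaken n n' lo lo' a b :
  n <= n' -> lo' <= lo -> walk G pi n lo a b -> walk G pi n' lo' a b.
Proof.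
move=> nn ll [s [Gs sb sn sl]]; exists s; split=> //; first exact: leq_trans nn.
by apply: sub_all sl => x; exact: leq_trans.
Qed.
End Walks.

(** * Signatures from a colouring of weak reachability in the cover graph *)

Section Signature.
Import Order.TTheory.
Local Open Scope order_scope.
Variables (d : Order.disp_t) (P : finPOrderType d) (h : nat).
Hypothesis height_le : (poset_height P <= h)%N.

Lemma covered_chain (x y : P) : x <= y -> exists2 s, path (@covered d P) x s & last x s = y.
Proof.
have [n] := ubnP #|[set z | x <= z <= y]%SET|; elim: n x y => // n IH x y xyn xy.
have [->|nxy] := eqVneq x y; first by exists [::].
have [cxy|] := boolP (covered x y); first by exists [:: y]; rewrite //= cxy.
rewrite /covered lt_neqAle nxy xy /= negbK => /existsP[z /andP[xz zy]].
have small (a b : P) : x <= a -> b <= y -> (x < a) || (b < y) ->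
    (#|[set t | (a <= t <= b)%O]%SET| < n)%N.
  move=> xa yb ab; rewrite ltnS in xyn; apply: (leq_trans _ xyn); apply/proper_card/properP; split.
    apply/fintype.subsetP => t; rewrite !inE => /andP[at_ tb].
    by rewrite (le_trans xa) ?(le_trans tb).
  case/orP: ab => [lt|lt]; [exists x|exists y]; rewrite !inE ?lexx ?xy //=.
    by rewrite lt_geF.
  by rewrite (lt_geF lt) andbF.
have [s sp sl] := IH x z (small x z (lexx x) (ltW zy) (introT orP (or_intror zy))) (ltW xz).
have [t tp tl] := IH z y (small z y (ltW xz) (lexx y) (introT orP (or_introl xz))) (ltW zy).
by exists (s ++ t); rewrite ?cat_path ?last_cat sl ?sp.
Qed.

Lemma covered_path_le (x : P) s : path (@covered d P) x s -> x <= last x s.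
Proof.
elim: s x => [//|y s IH] x /= /andP[/andP[/ltW xy _] /IH]; exact: le_trans.
Qed.

Lemma covered_path_size (x : P) s : path (@covered d P) x s -> (size s <= h)%N.
Proof.
move=> cs; have lts : sorted <%O (x :: s).
  by apply: sub_path cs => a b /andP[].
have us : uniq (x :: s) by exact: (sorted_uniq lt_trans ltxx lts).
have ch : chain [set z in x :: s]%SET.
  apply/forall_inP => a; rewrite finset.in_set => aS.
  apply/forall_inP => b; rewrite finset.in_set => bS.
  have les : sorted <=%O (x :: s) by apply: sub_path lts => u v /ltW.
  have mono := sorted_leq_nth le_trans lexx x les.
  rewrite -(nth_index x aS) -(nth_index x bS) /Order.comparable.
  case: (leqP (index a (x :: s)) (index b (x :: s))) => [ab|/ltnW ab].
    by rewrite mono ?inE ?index_mem.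
  by rewrite orbC mono ?inE ?index_mem.
have le1 : (#|[set z in x :: s]%SET| <= poset_height P)%N.
  by rewrite /poset_height; exact: (leq_bigmax_cond _ ch).
move: le1; rewrite cardsE (card_uniqP us) => le1.
exact: ltnW (leq_trans le1 height_le).
Qed.

Let G : rel P := cover_graph P.
Variables (pi : P -> nat) (B : nat) (phi : P -> 'I_B).
Hypothesis piI : injective pi.
Hypothesis phiP : forall v w, walk G pi (3 * h) (pi w) v w -> phi v = phi w -> v = w.

Let symG : symmetric G. Proof. exact: adj_sym. Qed.

Definition climbs (lo : nat) (x y : P) : Prop :=
  exists s, [/\ path (@covered d P) x s, last x s = y & all (fun z => lo <= pi z)%N (x :: s)].

Lemma climbs_walk lo x y : climbs lo x y -> walk G pi h lo x y.
Proof.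
move=> [s [cs sl sa]]; exists s; split=> //; last exact: covered_path_size cs.
by apply: sub_path cs => a b cab; apply/orP; left.
Qed.

Lemma climbs_le lo x y : climbs lo x y -> x <= y.
Proof. by move=> [s [/covered_path_le + <- _]]. Qed.

Lemma same_colour n lo v w :
  (n <= 3 * h)%N -> walk G pi n lo v w -> (pi w <= lo)%N -> phi v = phi w -> v = w.
Proof. by move=> nh vw wlo; apply: phiP; apply: walk_weaken vw. Qed.

Let up (x : P) (i : 'I_B) := [pick u | `[< climbs (pi u) x u >] && (phi u == i)].
Let dn (y : P) (i : 'I_B) := [pick v | `[< climbs (pi v) v y >] && (phi v == i)].

(** The third bit carries information only if both vertices exist; otherwise it is filled with
    [false]. *)
Definition reach_signature (x y : P) : {ffun 'I_B -> bool * bool * bool} :=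
  [ffun i => (isSome (up x i), isSome (dn y i),
    if up x i is Some u then if dn y i is Some v then (pi u < pi v)%N else false else false)].

Let upP x i u : up x i = Some u -> climbs (pi u) x u /\ phi u = i.
Proof.
by rewrite /up; case: pickP => // u' /andP[/asboolP ? /eqP ?] [<-].
Qed.

Let dnP y i v : dn y i = Some v -> climbs (pi v) v y /\ phi v = i.
Proof.
by rewrite /dn; case: pickP => // v' /andP[/asboolP ? /eqP ?] [<-].
Qed.

(** The choice made by [up] is unique: two candidates of one colour are joined through [x] by a walk
    of length at most [2 * h] that stays above the lower one in [pi], so they coincide. *)
Let up_mem x u : climbs (pi u) x u -> up x (phi u) = Some u.
Proof.
move=> xu; case E: (up x (phi u)) => [u'|]; last first.
  move: E; rewrite /up; case: pickP => // /(_ u); rewrite eqxx andbT => /asboolP.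
  by [].
have [xu' pE] := upP E; congr Some.
have main a b : climbs (pi a) x a -> climbs (pi b) x b -> phi a = phi b ->
    (pi a <= pi b)%N -> b = a.
  move=> xa xb ab le; apply: (same_colour (n := (h + h)%N) (lo := pi a)) => //.
    lia.
  apply: walk_trans (climbs_walk xa).
  by apply: walk_weaken (walk_sym symG (climbs_walk xb)).
case: (leqP (pi u) (pi u')) => [le|/ltnW le]; first exact: main.
by apply/esym/main.
Qed.

Let dn_mem y v : climbs (pi v) v y -> dn y (phi v) = Some v.
Proof.
move=> vy; case E: (dn y (phi v)) => [v'|]; last first.
  move: E; rewrite /dn; case: pickP => // /(_ v); rewrite eqxx andbT => /asboolP.
  by [].
have [vy' pE] := dnP E; congr Some.
have main a b : climbs (pi a) a y -> climbs (pi b) b y -> phi a = phi b ->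
    (pi a <= pi b)%N -> b = a.
  move=> ya yb ab le; apply: (same_colour (n := (h + h)%N) (lo := pi a)) => //.
    lia.
  apply: (walk_trans (b := y)); last exact: walk_sym (climbs_walk ya).
  by apply: walk_weaken (climbs_walk yb).
case: (leqP (pi v) (pi v')) => [le|/ltnW le]; first exact: main.
by apply/esym/main.
Qed.

(** Go from [u] down to [x], up to [y] and down to [v]. Three climbs of length at most [h] explain
    the radius [3 * h]; the walk stays above the lesser of [pi u] and [pi v], so equal colours force
    equality. *)
Let link m x y u v : climbs m x y -> climbs (pi u) x u -> climbs (pi v) v y ->
  phi u = phi v -> (pi u <= m)%N || (pi v <= m)%N -> u = v.
Proof.
move=> /climbs_walk xy /climbs_walk/(walk_sym symG) ux /climbs_walk/(walk_sym symG) yv uv le.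
pose lo := minn (pi u) (pi v).
have w : walk G pi (h + h + h) lo u v.
  apply: walk_trans (walk_weaken (leqnn h) (geq_minr _ _) yv).
  apply: walk_trans (walk_weaken (leqnn h) (geq_minl _ _) ux) _.
  by apply: walk_weaken xy => //; rewrite /lo geq_min.
have hh : (h + h + h <= 3 * h)%N by lia.
case: (leqP (pi u) (pi v)) => [le'|/ltnW le'].
  apply/esym; apply: (same_colour hh (walk_sym symG w)) => //.
  by rewrite /lo (minn_idPl le').
by apply: (same_colour hh w) => //; rewrite /lo (minn_idPr le').
Qed.

Lemma reach_signature_acyclic c (Z : {set P * P}) : Z != finset.set0 ->
  (forall p, p \in Z -> [/\ ~~ (p.1 <= p.2), reach_signature p.1 p.2 = c,
     exists2 q, q \in Z & p.1 <= q.2 & exists2 q, q \in Z & q.1 <= p.2]) -> False.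
Proof.
move=> /set0Pn[p0 p0Z] ZP.
pose wit z := `[< exists p q s, [/\ p \in Z, q \in Z, path (@covered d P) p.1 s,
  last p.1 s = q.2 & z \in p.1 :: s] >].
have wit0 : wit p0.1.
  have [_ _ [q qZ pq] _] := ZP p0 p0Z; have [s cs sl] := covered_chain pq.
  by apply/asboolP; exists p0, q, s; rewrite mem_head.
have [z /asboolP[p [q [s [pZ qZ cs sl zs]]]] zmin] := arg_minnP pi wit0.
have Zclimbs a b : a \in Z -> b \in Z -> a.1 <= b.2 -> climbs (pi z) a.1 b.2.
  move=> aZ bZ ab; have [t ct tl] := covered_chain ab; exists t; split=> //.
  by apply/allP => x xt; apply: zmin; apply/asboolP; exists a, b, t.
have pz : climbs (pi z) p.1 z /\ climbs (pi z) z q.2.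
  have : all (fun x => pi z <= pi x)%N (p.1 :: s).
    by apply/allP => x xt; apply: zmin; apply/asboolP; exists p, q, s.
  case/splitPl: zs cs sl => s1 s2 s1z; rewrite cat_path last_cat s1z => /andP[c1 c2] sl.
  rewrite -cat_cons all_cat => /andP[a1 a2]; split; first by exists s1.
  by exists s2; rewrite /= leqnn.
have [/up_mem upz /dn_mem dnz] := pz.
pose i := phi z.
have [_ sp _ _] := ZP p pZ; have [_ sq _ _] := ZP q qZ.
(* [p.1] climbs to [z] and [q.2] descends to [z], so the constant signature provides vertices of the
   colour of [z] for every pair in [Z]. *)
have ci a : a \in Z -> exists u v, [/\ up a.1 i = Some u, dn a.2 i = Some v &
    (pi u < pi v)%N = (c i).2].
  move=> aZ; have [_ sa _ _] := ZP a aZ.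
  move: (congr1 (fun f : {ffun _} => (f i).1.1) (etrans sa (esym sp))).
  move: (congr1 (fun f : {ffun _} => (f i).1.2) (etrans sa (esym sq))).
  move: (congr1 (fun f : {ffun _} => (f i).2) sa).
  rewrite !ffunE /= upz dnz; case: (up a.1 i) => // u; case: (dn a.2 i) => // v.
  by move=> E _ _; exists u, v.
have neq a u v : a \in Z -> up a.1 i = Some u -> dn a.2 i = Some v -> u <> v.
  move=> aZ /upP[/climbs_le au _] /dnP[/climbs_le va _] uv.
  by have [/negP[]] := ZP a aZ; rewrite (le_trans au) // uv.
case ciE : (c i).2 in ci.
(* Pass from [a] to a successor [b]: by [link], the vertex above [a.1] is the one below [b.2], so
   the latter has smaller rank than the one below [a.2]. *)
- have main n a v : a \in Z -> dn a.2 i = Some v -> (pi v < n)%N -> (pi v <= pi z)%N -> False.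
    elim: n a v => // n IH a v aZ av vn vz.
    have [u [v' [au av']]] := ci a aZ; move: av'; rewrite av => -[<-] uv.
    have [_ _ [b bZ ab] _] := ZP a aZ.
    have [_ [w [_ bw _]]] := ci b bZ.
    have [cu fu] := upP au; have [cw fw] := dnP bw.
    have E : u = w.
      apply: (link (Zclimbs a b aZ bZ ab) cu cw); first by rewrite fu fw.
      by rewrite (leq_trans (ltnW uv) vz).
    apply: (IH b w bZ bw); rewrite -E; first exact: leq_trans uv _.
    exact: leq_trans (ltnW uv) vz.
  exact: (main (pi z).+1 q z qZ dnz).
(* Dually, pass to a predecessor. The comparison is strict because [u = v] would give
   [a.1 <= a.2]. *)
- have main n a u : a \in Z -> up a.1 i = Some u -> (pi u < n)%N -> (pi u <= pi z)%N -> False.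
    elim: n a u => // n IH a u aZ au un uz.
    have [u' [v [au' av]]] := ci a aZ; move: au'; rewrite au => -[<-] uv.
    have vu : (pi v < pi u)%N.
      rewrite ltn_neqAle leqNgt uv andbT; apply/eqP => /piI vu.
      exact: (neq a u v).
    have [_ _ _ [b bZ ba]] := ZP a aZ.
    have [w [_ [bw _ _]]] := ci b bZ.
    have [cw fw] := upP bw; have [cv fv] := dnP av.
    have E : w = v.
      apply: (link (Zclimbs b a bZ aZ ba) cw cv); first by rewrite fw fv.
      by rewrite (leq_trans (ltnW vu) uz) orbT.
    apply: (IH b w bZ bw); rewrite E; first exact: leq_trans vu _.
    exact: leq_trans (ltnW vu) uz.
  exact: (main (pi z).+1 p z pZ upz).
Qed.

End Signature.

(** * Arcs in the half-plane *)

Lemma addb_telescope (h v : nat -> bool) (w : nat -> bool) N :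
  (forall i, i < N -> h i (+) w i = v i (+) v i.+1) ->
  \big[addb/false]_(i < N) h i (+) \big[addb/false]_(i < N) w i = v 0 (+) v N.
Proof.
elim: N => [|N IH] hv; first by rewrite !big_ord0; case: (v 0).
rewrite !big_ord_recr /= addbACA IH; last by move=> i /ltnW; apply: hv.
by rewrite hv //; case: (v 0); case: (v N); case: (v N.+1).
Qed.

(* [b] tells on which side of the x-axis a grid point is sent, and [pos] whether
   its first coordinate is positive: the number of boundary edges crossing the
   positive half-axis would be odd, while every cell contributes an even number. *)
Lemma grid_parity N (b pos : nat -> nat -> bool) :
  1 < N ->
  (forall i j, i < N -> j < N ->
     [/\ b i j = b i.+1 j, b i j = b i j.+1 & b i j = b i.+1 j.+1] \/
     [/\ pos i j = pos i.+1 j, pos i j = pos i j.+1 & pos i j = pos i.+1 j.+1]) ->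
  (forall i, i <= N -> b i 0 = false /\ b i N = false) ->
  (forall j, 0 < j < N -> b 0 j = true /\ b N j = true) ->
  pos 0 0 = false -> pos 0 N = false -> pos N 0 = true -> pos N N = false ->
  False.
Proof.
move=> N1 cell bh bv p00 p0N pN0 pNN.
pose h i j := (b i j (+) b i.+1 j) && pos i j.
pose v i j := (b i j (+) b i j.+1) && pos i j.
pose H j := \big[addb/false]_(i < N) h i j.
(* Either [b] is constant on a cell and nothing crosses, or [pos] is constant there and the changes
   of [b] around the cell cancel. *)
have strip j : j < N -> H j (+) H j.+1 = v 0 j (+) v N j.
  move=> jN; rewrite /H; apply: (@addb_telescope (h^~ j) (v^~ j) (h^~ j.+1)) => i iN.
  rewrite /h /v; case: (cell i j iN jN) => -[]; first by move=> <- <- <-; rewrite addbb.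
  move=> <- <- _.
  by case: (pos i j); rewrite ?andbF ?andbT; case: (b i j); case: (b i.+1 j);
     case: (b i j.+1); case: (b i.+1 j.+1).
have HN j : j <= N -> H 0 (+) H j = \big[addb/false]_(l < j) (v 0 l (+) v N l).
  elim: j => [|j IH] jN; first by rewrite big_ord0 addbb.
  rewrite big_ord_recr /= -IH 1?ltnW // -strip //.
  by case: (H 0); case: (H j); case: (H j.+1).
have H0 : H 0 = false.
  rewrite /H big1 // => i _; rewrite /h.
  by case: (bh i) => [|->]; rewrite 1?ltnW //; case: (bh i.+1) => [|->].
have HNN : H N = false.
  rewrite /H big1 // => i _; rewrite /h.
  by case: (bh i) => [|_ ->]; rewrite 1?ltnW //; case: (bh i.+1) => [|_ ->].
move: (HN N (leqnn N)); rewrite H0 HNN.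
clear HN HNN H0 strip; have [M NE] : exists M, N = M.+2 by exists N.-2; lia.
subst N.
rewrite big_ord_recl big_ord_recr big1 /=; last first.
  move=> i _; rewrite /v /= /bump /=.
  have iM := ltn_ord i.
  have [|-> ->] := bv (1 + i); first by lia.
  by have [|-> ->] := bv (1 + i).+1; first by lia.
rewrite /v /bump /= p00 pN0 !andbF.
have [-> _] := bh M.+2 (leqnn _).
have [|_ ->] := bv 1; first by lia.
have [|b0 bN] := bv (1 + M); first by lia.
have [_ c0] := bh 0 isT; have [_ cN] := bh M.+2 (leqnn _).
(* [pos] is given only at the corners of the grid. In the two top corner cells [b] is not constant,
   so [pos] is. *)
have := cell 0 (1 + M) isT; rewrite b0 => -[]; first by lia.
  by rewrite c0 => -[].
move=> [_ -> _]; rewrite p0N andbF.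
have := cell M.+1 (1 + M); rewrite bN => -[]; try lia.
  by rewrite cN => -[-> _].
by move=> [<- _ ->]; rewrite pNN cN.
Qed.

Section HalfPlane.
Import Order.TTheory GRing.Theory Num.Theory.
Import numFieldNormedType.Exports.
Local Open Scope classical_set_scope.
Local Open Scope ring_scope.
Variable R : realType.

Lemma within_itv_continuous_eps (f : R -> R * R) (s0 e : R) :
  {within `[0, 1], continuous f} -> 0 <= s0 <= 1 -> 0 < e ->
  exists2 d : R, 0 < d & forall s, 0 <= s <= 1 -> `|s - s0| < d ->
    `|(f s).1 - (f s0).1| < e /\ `|(f s).2 - (f s0).2| < e.
Proof.
move=> /subspace_continuousP fc s01 e0.
have /fc /cvgrPdist_lt /(_ _ e0) : `[0, 1]%classic s0 by rewrite /= in_itv.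
rewrite near_withinE => /nbhs_ballP [d /= d0 dP].
exists d => // s ss ssd.
have /dP : ball s0 d s by rewrite /ball /= distrC.
rewrite /= in_itv /= => /(_ ss); rewrite prod_normE gt_max /=.
by case/andP; rewrite distrC => -> /=; rewrite distrC => ->.
Qed.

(** Otherwise [f s - g t] never vanishes on the unit square. By compactness, on each cell of a fine
    grid one coordinate keeps a strict sign, while the signs on the boundary are those of a curve
    winding once around the origin; [grid_parity] forbids this. *)
Lemma half_plane_arcs_meet (f g : R -> R * R) (a b c d : R) :
  {within `[0, 1], continuous f} -> {within `[0, 1], continuous g} ->
  (forall s : R, 0 <= s <= 1 -> 0 <= (f s).2) ->
  (forall s : R, 0 <= s <= 1 -> 0 <= (g s).2) ->
  f 0 = (a, 0) -> f 1 = (c, 0) -> g 0 = (b, 0) -> g 1 = (d, 0) ->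
  a < b -> b < c -> c < d ->
  exists s t : R, [/\ 0 <= s <= 1, 0 <= t <= 1 & f s = g t].
Proof.
move=> fc gc f0 g0 fa fcc gb gd ab bc cd; apply: contrapT => nmeet.
pose K := `[0 : R, 1] `*` `[0 : R, 1].
have KE p : K p <-> (0 <= p.1 <= 1) /\ (0 <= p.2 <= 1) by rewrite /K /= !in_itv.
pose D (u : bool) (p : R * R) :=
  if u then (f p.1).1 - (g p.2).1 else (f p.1).2 - (g p.2).2.
pose Z (u w : bool) (p : R * R) := if w then D u p else - D u p.
pose P (n : nat) (p : R * R) := exists u w, forall q, K q ->
  `|q.1 - p.1| <= n.+1%:R^-1 -> `|q.2 - p.2| <= n.+1%:R^-1 -> 0 < Z u w q.
have nz p : K p -> exists u w, 0 < Z u w p.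
  move=> /KE [p1 p2]; apply: contrapT => nuw.
  have zero u : D u p = 0.
    case: (ltgtP (D u p) 0) => // Du.
    - by case: nuw; exists u, false; rewrite /Z oppr_gt0.
    - by case: nuw; exists u, true.
  apply: nmeet; exists p.1, p.2; split=> //.
  move: (zero true) (zero false) => /= /subr0_eq e1 /subr0_eq e2.
  by case: (f p.1) (g p.2) e1 e2 => ? ? [? ?] /= -> ->.
have le3 (x y z u v : R) : x <= z -> z < u / 2 -> y < u / 2 -> u <= v -> x + y < v.
  by move=> *; lra.
have close_gt (x y x' y' : R) :
    `|x' - x| < (x - y) / 2 -> `|y' - y| < (x - y) / 2 -> 0 < x' - y'.
  by rewrite !ltr_norml => /andP[? ?] /andP[? ?]; lra.
have /compact_near_coveringP Kc : compact K.
  by apply: compact_setX; apply: segment_compact.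
have [N _ NP] : \forall n \near \oo, K `<=` P n.
  apply: Kc => p' Kp'; pose p : R * R := p'; have Kp : K p := Kp'; have [u [w Zp]] := nz p Kp.
  have e0 : 0 < Z u w p / 2 by rewrite divr_gt0.
  have /KE [p1 p2] := Kp.
  have [df df0 dfP] := within_itv_continuous_eps fc p1 e0.
  have [dg dg0 dgP] := within_itv_continuous_eps gc p2 e0.
  pose e := Num.min df dg.
  have ep : 0 < e / 2 by rewrite divr_gt0 // lt_min df0 dg0.
  (* Half of the radius is for the centre [q] and half for the box around it. *)
  exists (ball p (e / 2), [set n : nat | n.+1%:R^-1 < e / 2]) => /=; last first.
    move=> [q n] [/= [q1 q2] nP]; exists u, w => r /KE [r1 r2] rq1 rq2.
    have edf : e <= df by rewrite ge_min lexx.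
    have edg : e <= dg by rewrite ge_min lexx orbT.
    have h1 : `|r.1 - p.1| < df.
      have q1' : `|p.1 - q.1| < e / 2 by exact: q1.
      apply: le_lt_trans (ler_distD q.1 _ _) _.
      by rewrite [`|q.1 - _|]distrC; rewrite /= in nP; apply: le3 rq1 nP q1' edf.
    have h2 : `|r.2 - p.2| < dg.
      have q2' : `|p.2 - q.2| < e / 2 by exact: q2.
      apply: le_lt_trans (ler_distD q.2 _ _) _.
      by rewrite [`|q.2 - _|]distrC; rewrite /= in nP; apply: le3 rq2 nP q2' edg.
    move: (dfP _ r1 h1) (dgP _ r2 h2); rewrite /Z /D.
    case: (u); case: (w) => -[f1 f2] [g1 g2]; rewrite ?opprB;
      rewrite ?opprB in f1 f2 g1 g2; by apply: close_gt; eassumption.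
  split; first exact: nbhsx_ballx.
  by apply: near_infty_natSinv_lt (PosNum ep).
(* The grid has [M.+1] steps per side: its mesh is the box radius in [P M], and there are at least
   two steps, as [grid_parity] requires. *)
pose M := N.+1; pose pt (i j : nat) : R * R := (i%:R / M.+1%:R, j%:R / M.+1%:R).
have M0 : 0 < M.+1%:R :> R by rewrite ltr0n.
have coord i : (i <= M.+1)%N -> 0 <= (i%:R / M.+1%:R : R) <= 1.
  by move=> iM; rewrite divr_ge0 //= ler_pdivrMr // mul1r ler_nat.
have Kpt i j : (i <= M.+1)%N -> (j <= M.+1)%N -> K (pt i j).
  by move=> iM jM; apply/KE; split; exact: coord.
(* Points sent to the x-axis may be counted on either side; this choice makes
   [bb] constant on the interior of each side of the grid. *)
pose bb (i j : nat) : bool :=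
  if (0 < j < M.+1)%N then ((i == 0) || (i == M.+1))%N || (D false (pt i j) < 0)
  else false.
pose pos (i j : nat) : bool := 0 < D true (pt i j).
have pt0 (i : nat) : (0%:R / M.+1%:R : R) = 0 by rewrite mul0r.
have pt1 : (M.+1%:R / M.+1%:R : R) = 1 by rewrite divff // gt_eqF.
have bbP i j : (i <= M.+1)%N -> (j <= M.+1)%N ->
    if bb i j then D false (pt i j) <= 0 else 0 <= D false (pt i j).
  move=> iM jM; rewrite /bb.
  have [jb|jb] := boolP (0 < j < M.+1)%N.
    have [ib|ib] /= := boolP ((i == 0) || (i == M.+1))%N.
      have -> : (f (pt i j).1).2 = 0.
        by case/orP: ib => /eqP -> /=; rewrite ?pt0 ?pt1 ?fa ?fcc.
      by rewrite sub0r oppr_le0 g0 //=; exact: coord.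
    by case: ltP => // /ltW.
  rewrite /=; have -> : (g (pt i j).2).2 = 0.
    have /orP[] : (j == 0)%N || (j == M.+1) by lia.
      by move=> /eqP -> /=; rewrite pt0 // gb.
    by move=> /eqP -> /=; rewrite pt1 gd.
  by rewrite subr0 f0 //; exact: coord.
have bb_pos i j : (i <= M.+1)%N -> (j <= M.+1)%N ->
    0 < D false (pt i j) -> bb i j = false.
  by move=> iM jM; move: (bbP i j iM jM); case: (bb i j) => // /le_gtF ->.
have bb_neg i j : (i <= M.+1)%N -> (j <= M.+1)%N ->
    D false (pt i j) < 0 -> bb i j = true.
  by move=> iM jM; move: (bbP i j iM jM); case: (bb i j) => // /le_gtF ->.
have step i : `|i.+1%:R / M.+1%:R - i%:R / M.+1%:R| <= M.+1%:R^-1 :> R.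
  by rewrite -mulrBl -natrB // subSnn mul1r ger0_norm // invr_ge0 ltW.
have step0 i : `|i%:R / M.+1%:R - i%:R / M.+1%:R| <= M.+1%:R^-1 :> R.
  by rewrite subrr normr0 invr_ge0 ltW.
apply: (@grid_parity M.+1 bb pos) => //.
- move=> i j iM jM.
  have [u [w cell]] := NP M (leqnSn N) (pt i j) (Kpt i j (ltnW iM) (ltnW jM)).
  have c00 := cell _ (Kpt i j (ltnW iM) (ltnW jM)) (step0 i) (step0 j).
  have c10 := cell _ (Kpt i.+1 j iM (ltnW jM)) (step i) (step0 j).
  have c01 := cell _ (Kpt i j.+1 (ltnW iM) jM) (step0 i) (step j).
  have c11 := cell _ (Kpt i.+1 j.+1 iM jM) (step i) (step j).
  move: c00 c10 c01 c11; rewrite /Z; clear cell.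
  case: u => c00 c10 c01 c11; [right|left].
    move: c00 c10 c01 c11; rewrite /pos; case: w; first by move=> -> -> -> ->.
    by rewrite !oppr_gt0 => /lt_gtF-> /lt_gtF-> /lt_gtF-> /lt_gtF->.
  move: c00 c10 c01 c11; case: w; rewrite ?oppr_gt0 => c00 c10 c01 c11.
    by rewrite (bb_pos i j (ltnW iM) (ltnW jM)) // (bb_pos i.+1 j iM (ltnW jM)) // (bb_pos i j.+1 (ltnW iM) jM) //
       (bb_pos i.+1 j.+1 iM jM).
    by rewrite (bb_neg i j (ltnW iM) (ltnW jM)) // (bb_neg i.+1 j iM (ltnW jM)) // (bb_neg i j.+1 (ltnW iM) jM) //
       (bb_neg i.+1 j.+1 iM jM).
- by move=> i _; rewrite /bb /= ltnn.
- by move=> j jb; rewrite /bb jb /= eqxx.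
- by rewrite /pos /= !pt0 // fa gb /= subr_gt0 lt_gtF.
- by rewrite /pos /= pt0 // pt1 fa gd /= subr_gt0 lt_gtF // (lt_trans ab) // (lt_trans bc).
- by rewrite /pos /= pt0 // pt1 fcc gb /= subr_gt0.
- by rewrite /pos /= pt1 fcc gd /= subr_gt0 lt_gtF.
Qed.
End HalfPlane.

(** * From book embeddings to stack layouts *)

Section Layout.
Import Order.TTheory GRing.Theory Num.Theory.
Variables (R : realType) (T : finType) (G : sgraph T).

(** Interleaving ends make the two arcs meet, and on a common page they may meet only at a common
    end, but the four ends are distinct. *)
Lemma book_embedding_noncrossing k pos page draw x y z w :
  @is_book_embedding R T G k pos page draw ->
  G x y -> G z w -> page [set x; y] = page [set z; w] ->
  ~ [/\ (pos x < pos z)%R, (pos z < pos y)%R & (pos y < pos w)%R].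
Proof.
move=> [posI _ arcP halfP _ crossP] Gxy Gzw pgE [xz zy yw].
have edge a b : G a b -> [set a; b] \in edge_set G.
  by move=> Gab; apply/imsetP; exists (a, b); rewrite ?inE.
have [f [fc _ f0 f1 fE]] := arcP _ _ Gxy.
have [g [gc _ g0 g1 gE]] := arcP _ _ Gzw.
have [||s [t [s01 t01 fg]]] := half_plane_arcs_meet fc gc _ _ f0 f1 g0 g1 xz zy yw.
- move=> s s01; apply: (halfP _ (edge _ _ Gxy)); rewrite fE.
  by exists s => //=; rewrite in_itv.
- move=> s s01; apply: (halfP _ (edge _ _ Gzw)); rewrite gE.
  by exists s => //=; rewrite in_itv.
have nE : [set x; y] != [set z; w].
  apply/eqP => /setP /(_ x); rewrite !inE eqxx /=.
  case/esym/orP => /eqP E; move: xz zy yw; rewrite E ?ltxx // => xz zy yw.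
  by move: (lt_trans xz (lt_trans zy yw)); rewrite ltxx.
have := crossP _ _ (edge _ _ Gxy) (edge _ _ Gzw) nE pgE (f s).
case=> [|v /= vI _].
  split; first by rewrite fE; exists s => //=; rewrite in_itv.
  by rewrite fg gE; exists t => //=; rewrite in_itv.
have xw := lt_trans xz (lt_trans zy yw).
move: vI; rewrite !inE => /andP[/orP[]/eqP-> /orP[]/eqP E];
  by move: xz zy yw xw; rewrite E ltxx.
Qed.

Lemma book_embedding_stack_layout k :
  has_book_embedding R G k -> exists rk pg, stack_layout G k rk pg.
Proof.
move=> [pos [page [draw B]]].
(* Counting the vertices to the left turns real positions into natural numbers with the same
   order. *)
pose rk v := #|[set u | (pos u < pos v)%R]|.
have rk_lt u v : (pos u < pos v)%R -> rk u < rk v.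
  move=> uv; apply/proper_card/properP; split.
    by apply/fintype.subsetP => z; rewrite !inE => /lt_trans; apply.
  by exists u; rewrite !inE ?ltxx.
have rk_ltE u v : (rk u < rk v) = (pos u < pos v)%R.
  apply/idP/idP => [|/rk_lt //]; apply: contraTT.
  rewrite -leNgt -leqNgt le_eqVlt => /orP[/eqP/(pos_inj B) ->//|/rk_lt].
  exact: ltnW.
exists rk, (fun x y => page [set x; y]); split.
- move=> u v rkE; apply: (pos_inj B); apply/eqP.
  by rewrite eq_le !leNgt -!rk_ltE rkE ltnn.
- by move=> x y; rewrite finset.setUC.
- by move=> x y Gxy; apply: (page_lt B); apply/imsetP; exists (x, y); rewrite ?inE.
- move=> x y z w Gxy Gzw pgE; rewrite !rk_ltE.
  exact: book_embedding_noncrossing B Gxy Gzw pgE.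
Qed.

End Layout.

Lemma book_thickness_embedding (R : realType) (T : finType) (G : sgraph T) k :
  book_thickness R G <= k -> exists2 k', k' <= k & has_book_embedding R G k'.
Proof.
by rewrite /book_thickness; case: ex_minnP => m /asboolP ? _ mk; exists m.
Qed.

Lemma poset_dim_le_realizer d (P : finPOrderType d) n :
  has_realizer P n -> poset_dim P <= n.
Proof.
by move=> Pn; rewrite /poset_dim; case: ex_minnP => m _; apply; apply/asboolP.
Qed.

Theorem mainTheorem4 (R : realType) :
  exists g : nat -> nat -> nat,
    forall k h : nat, 1 <= h ->
    forall (disp : Order.disp_t) (P : finPOrderType disp),
      poset_height P = h ->
      book_thickness R (cover_graph P) <= k ->
      poset_dim P <= g k h.
Proof.
(* The bound is the number of signatures, for a colouring of radius [3 * h]. *)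
exists (fun k h => #|{ffun 'I_(colour_bound k (3 * h)) -> bool * bool * bool}|).
move=> k h _ disp P Ph /book_thickness_embedding[k' k'k].
move=> /book_embedding_stack_layout[rk [pg [rkI pgC pgk' ncr]]].
have lay : stack_layout (cover_graph P) k rk pg.
  by split=> // x y /pgk' /leq_trans; apply.
have [pi [phi [piI phiP]]] := stack_layout_colouring (3 * h) (adj_sym _) lay.
have height_le : poset_height P <= h by rewrite Ph.
apply/poset_dim_le_realizer/no_alternating_cycle_realizer => c Z.
exact: (reach_signature_acyclic height_le piI phiP).
Qed.
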